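(* For every dimension $d\ge1$ there exists a constant $C>0$, depending only on $d$, such that for every $\Lambda>0$ and every periodic function $u:[0,\Lambda]^d\to\mathbb{R}$ with $u\ge 0$ and $\Lambda^{-d}\int_{[0,\Lambda]^d}u\,dx=1$, $$\|(u-C)_+\|_{\frac{2+3d}{3d}}\;\le\; C\,\big(\|\nabla u\|_1\big)^{\frac{2d}{2+3d}}\,\big(W_2^2(u,1)\big)^{\frac{d}{2+3d}},$$ where $(u-C)_+:=\max\{u-C,0\}$.
   Context: Periodic means $\Lambda$-periodic in each coordinate, i.e. $u$ is a function on the torus $[0,\Lambda]^d$. $\|f\|_p=\left(\int_{[0,\Lambda]^d}|f|^p\,dx\right)^{1/p}$ (integral, not average). $\|\nabla u\|_1=\int_{[0,\Lambda]^d}|\nabla u|\,dx$, understood as the total variation of the distributional gradient on the torus when $u$ is merely of bounded variation. $W_2$ denotes the Wasserstein distance: for nonnegative densities $u,v$ with equal total mass, $$W_2^2(u,v):=\inf_\pi\iint|x-y|^2\,d\pi(x,y),$$ the infimum being over nonnegative measures $\pi$ on the product space whose projections on the first and second coordinates are the measures with densities $u$ and $v$, respectively. In the periodic setting $|x-y|$ is the distance on the torus $[0,\Lambda]^d$. $W_2(u,1)$ is the distance from $u$ to the constant density $1$. The inequality is understood for $u$ such that the right-hand side quantities are finite. *)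

(* Defs.v *)
From HB Require Import structures.
From mathcomp Require Import all_boot all_order all_algebra.
From mathcomp Require Import all_classical all_reals all_analysis.

Set Implicit Arguments.
Unset Strict Implicit.
Unset Printing Implicit Defensive.

Import Order.TTheory GRing.Theory Num.Theory.
Import numFieldNormedType.Exports.

Local Open Scope classical_set_scope.
Local Open Scope ring_scope.

Definition measure_rV_display : measure_display -> measure_display.
Proof. exact. Qed.

(* The product sigma-algebra on row vectors; for T := R it coincides with the
   Borel sigma-algebra of the (sup-)normed space 'rV[R]_n. *)
Section measurable_rV.
Context {d} {T : measurableType d} (n : nat).

Let coor : 'I_n -> 'rV[T]_n -> T := fun i x => x ord0 i.

Let rV_set0 : g_sigma_preimage coor set0.
Proof. exact: sigma_algebra0. Qed.

Let rV_setC A : g_sigma_preimage coor A -> g_sigma_preimage coor (~` A).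
Proof. exact: sigma_algebraC. Qed.

Let rV_bigcup (F : _^nat) : (forall i, g_sigma_preimage coor (F i)) ->
  g_sigma_preimage coor (\bigcup_i (F i)).
Proof. exact: sigma_algebra_bigcup. Qed.

HB.instance Definition _ := @isMeasurable.Build (measure_rV_display d)
  'rV[T]_n (g_sigma_preimage coor) rV_set0 rV_setC rV_bigcup.

End measurable_rV.

Lemma measurable_coor d (T : measurableType d) n (i : 'I_n) :
  measurable_fun [set: 'rV[T]_n] (fun x : 'rV[T]_n => x ord0 i).
Proof.
move=> _ Y mY; rewrite setTI; apply: sub_sigma_algebra => /=.
rewrite -bigcup_seq/=; exists i => /=; first by rewrite mem_index_enum.
by exists Y => //; rewrite setTI.
Qed.

Lemma measurable_fun_rVP d1 d2 (T1 : measurableType d1)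
    (T2 : measurableType d2) n (f : T1 -> 'rV[T2]_n) :
  (forall i, measurable_fun [set: T1] (fun x => f x ord0 i)) ->
  measurable_fun [set: T1] f.
Proof.
move=> mf _ Y mY; rewrite setTI.
suff : (@measurable _ 'rV[T2]_n) `<=` image_set_system setT f measurable.
  by move=> /(_ _ mY); rewrite /image_set_system/= setTI.
apply: smallest_sub.
  by apply: sigma_algebra_image; exact: sigma_algebra_measurable.
rewrite -bigcup_seq => A [i _ [B mB <-]].
rewrite /image_set_system/= setTI setTI.
by have := mf i measurableT B mB; rewrite setTI.
Qed.

Lemma sigma_finite_prod d1 d2 (T1 : measurableType d1)
    (T2 : measurableType d2) (R : realType)
    (m1 : {sigma_finite_measure set T1 -> \bar R})
    (m2 : {sigma_finite_measure set T2 -> \bar R}) :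
  sigma_finite [set: T1 * T2] (m1 \x m2)%E.
Proof.
have /sigma_finiteP[F [TF ndF Foo]] := sigma_finiteT m1.
have /sigma_finiteP[G [TG ndG Goo]] := sigma_finiteT m2.
exists (fun k => F k `*` G k) => [|k].
- apply/esym/seteqP; split=> // -[x y] _.
  have [i _ Fix] : (\bigcup_i F i) x by rewrite -TF.
  have [j _ Gjy] : (\bigcup_j G j) y by rewrite -TG.
  exists (maxn i j) => //; split => /=.
  + by move: x Fix; exact/subsetPset/ndF/leq_maxl.
  + by move: y Gjy; exact/subsetPset/ndG/leq_maxr.
- have [mF Fk] := Foo k; have [mG Gk] := Goo k.
  split; first exact: measurableX.
  by rewrite product_measure1E// lte_mul_pinfty// ge0_fin_numE.
Qed.

Section rV_cons.
Context {R : realType} (n : nat).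

Definition rV_cons (p : measurableTypeR R * 'rV[R]_n) : 'rV[R]_n.+1 :=
  row_mx (const_mx p.1 : 'rV[R]_1) p.2.

Definition rV_uncons (v : 'rV[R]_n.+1) : measurableTypeR R * 'rV[R]_n :=
  (v ord0 ord0, rsubmx (v : 'rV[R]_(1 + n))).

Lemma rV_consK : cancel rV_cons rV_uncons.
Proof.
case=> x v; rewrite /rV_uncons /rV_cons /= row_mxKr; congr pair.
have -> : (ord0 : 'I_n.+1) = @lshift 1 n ord0 by exact: val_inj.
exact: etrans (row_mxEl _ _ _ _) (mxE _ _ _ _).
Qed.

Lemma measurable_rV_cons :
  measurable_fun [set: measurableTypeR R * 'rV[R]_n] rV_cons.
Proof.
apply: measurable_fun_rVP => i.
rewrite /rV_cons; case: (@splitP 1 n i) => j ij.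
- have -> : i = lshift n j by exact: val_inj.
  rewrite (_ : (fun x => _) = fst); first exact: measurable_fst.
  by apply/funext => p; exact: etrans (row_mxEl _ _ _ _) (mxE _ _ _ _).
- have -> : i = rshift 1 j by exact: val_inj.
  rewrite (_ : (fun x => _) = (fun v : 'rV[R]_n => v ord0 j) \o snd) //.
    by apply: measurableT_comp => //; exact: measurable_coor.
  by apply/funext => p; exact: row_mxEr.
Qed.

HB.instance Definition _ := isMeasurableFun.Build _ _ _ _ rV_cons
  measurable_rV_cons.

Lemma measurable_rV_uncons : measurable_fun [set: 'rV[R]_n.+1] rV_uncons.
Proof.
apply/measurable_fun_pairP; split; first exact: measurable_coor.
apply: measurable_fun_rVP => i /=.
rewrite (_ : (fun x => _) = (fun v : 'rV[R]_n.+1 => v ord0 (rshift 1 i))).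
  exact: measurable_coor.
by apply/funext => x /=; rewrite mxE.
Qed.

Variable m : {sigma_finite_measure set 'rV[R]_n -> \bar R}.

(* The product of Lebesgue measure on R and m, transported to 'rV[R]_n.+1. *)
Definition lebesgue_cons : set 'rV[R]_n.+1 -> \bar R :=
  pushforward (lebesgue_measure \x m)%E rV_cons.

Let lebesgue_cons0 : lebesgue_cons set0 = 0%E.
Proof. exact: measure0. Qed.

Let lebesgue_cons_ge0 A : (0 <= lebesgue_cons A)%E.
Proof. exact: measure_ge0. Qed.

Let lebesgue_cons_sigma_additive : semi_sigma_additive lebesgue_cons.
Proof. exact: measure_semi_sigma_additive. Qed.

HB.instance Definition _ := isMeasure.Build _ _ _ lebesgue_cons
  lebesgue_cons0 lebesgue_cons_ge0 lebesgue_cons_sigma_additive.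

Let sigma_finite_lebesgue_cons : sigma_finite setT lebesgue_cons.
Proof.
have [F FT mF] := sigma_finite_prod (@lebesgue_measure R) m.
exists (fun k => rV_uncons @^-1` F k).
  by rewrite -preimage_bigcup -FT preimage_setT.
move=> k; have [mFk Fkoo] := mF k; split.
  by rewrite -[X in measurable X]setTI; exact: measurable_rV_uncons.
rewrite /lebesgue_cons /pushforward -comp_preimage.
by rewrite (_ : _ \o _ = id) ?preimage_id//; apply/funext/rV_consK.
Qed.

HB.instance Definition _ := Measure_isSigmaFinite.Build _ _ _ lebesgue_cons
  sigma_finite_lebesgue_cons.

End rV_cons.

Section torus.
Context {R : realType}.

(* Lebesgue measure on R^n, as the n-fold product of lebesgue_measure. *)
Fixpoint lebesgue_rV (n : nat) : {sigma_finite_measure set 'rV[R]_n -> \bar R} :=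
  match n with
  | 0 => dirac (0 : 'rV[R]_0)
  | n'.+1 => lebesgue_cons (lebesgue_rV n')
  end.

Context {n : nat}.
Implicit Types (L : R) (u v : 'rV[R]_n -> R) (x y : 'rV[R]_n).

Definition cube L : set 'rV[R]_n := [set x | forall i, 0 <= x ord0 i <= L].

Lemma measurable_cube L : measurable (cube L).
Proof.
rewrite (_ : cube L = \big[setI/setT]_(i < n)
    ((fun x : 'rV[R]_n => x ord0 i) @^-1` `[0, L])); last first.
  rewrite -bigcap_seq; apply/seteqP; split => x /= h.
    by move=> i _ /=; rewrite in_itv/=; exact: h.
  by move=> i; have /= := h i (mem_index_enum _); rewrite in_itv.
apply: big_ind => // [|i _]; first exact: measurableI.
by rewrite -[X in measurable X]setTI; exact: measurable_coor.
Qed.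

(* Lebesgue measure of the torus (R / L Z)^n, carried by the fundamental domain
   [0, L]^n. *)
Definition torus_measure L := mrestr (lebesgue_rV n) (measurable_cube L).

HB.instance Definition _ L := Measure.on (torus_measure L).

Definition lattice_periodic (T : Type) L (f : 'rV[R]_n -> T) :=
  forall (i : 'I_n) x, f (x + L *: delta_mx 0 i) = f x.

(* The library norm on 'rV[R]_n is the sup norm. *)
Definition euclidean_norm x : R := Num.sqrt (\sum_i x 0 i ^+ 2).

Definition torus_dist L x y : R :=
  inf [set euclidean_norm (x - y + L *: map_mx intr k) | k in [set: 'rV[int]_n]].

Definition C1 (f : 'rV[R]_n -> 'rV[R]_n) :=
  (forall x, differentiable f x) /\ continuous (jacobian f).

Definition divergence (f : 'rV[R]_n -> 'rV[R]_n) x : R := \tr (jacobian f x).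

(* Total variation on the torus of the distributional gradient of u; it equals
   the integral of |grad u| when u is C^1. *)
Definition torus_variation L u : \bar R :=
  ereal_sup [set (\int[torus_measure L]_x (u x * divergence phi x)%:E)%E |
    phi in [set phi : 'rV[R]_n -> 'rV[R]_n |
      [/\ C1 phi, lattice_periodic L phi &
           forall x, euclidean_norm (phi x) <= 1]]].

(* The prescribed marginals vanish outside cube L, so a coupling is a measure on
   the product of two copies of the fundamental domain. *)
Definition coupling L u v
    (gamma : {measure set ('rV[R]_n * 'rV[R]_n)%type -> \bar R}) :=
  forall A : set 'rV[R]_n, measurable A ->
    gamma (fst @^-1` A) = (\int[torus_measure L]_(x in A) (u x)%:E)%E /\
    gamma (snd @^-1` A) = (\int[torus_measure L]_(x in A) (v x)%:E)%E.

Definition W2sq L u v : \bar R :=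
  ereal_inf [set (\int[gamma]_z (torus_dist L z.1 z.2 ^+ 2)%:E)%E |
    gamma in coupling L u v].

End torus.

(* Main.v *)
From HB Require Import structures.
Require Import Defs.
From mathcomp Require Import all_boot all_order all_algebra.
From mathcomp Require Import all_classical all_reals all_analysis.
From mathcomp Require Import measurable_realfun.
From mathcomp Require Import ring lra.

Set Implicit Arguments.
Unset Strict Implicit.
Unset Printing Implicit Defensive.

Import Order.TTheory GRing.Theory Num.Theory.
Import numFieldNormedType.Exports.

Local Open Scope classical_set_scope.
Local Open Scope ring_scope.

(** Write V for the total variation of u, W for the squared distance of u to
    the constant density 1, and beta = 8 ^ d.  Everything reduces to

      int (u - C)_+ ^ p <= K (A V + W / A ^ 2)   for every A > 0,

    with p = (2 + 3 d) / (3 d): the choice A ^ 3 = W / V then gives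
    2 K V ^ (2/3) W ^ (1/3), and the claim is its p-th root.

    Cut u at the levels c_k = beta ^ (k + 1) into slices u_k, which run from 0
    to delta_k = c_(k+1) - c_k.  Attach to level k the two lengths
    r_k = A / 4 ^ (k + 1) and rho_k = A 2 ^ (k + 1) / 4.  Let x satisfy
    u x >= c_(k+1), so that u_k x = delta_k, and average u_k over the cube with
    corner x and side r_k.

    - If the average is at most delta_k / 2, then u_k oscillates near x by
      delta_k / 2 at the scale r_k.  The measure of these points is at most
      2 / delta_k times the mean over shifts w in the unit cube of
      int |u_k (x + r_k w) - u_k x| dx.
    - Otherwise x lies in a set G around whose points u carries a lot of mass.
      A transport plan that moves mass by less than rho_k can only place the
      mass found within r_k of G in a neighbourhood of G, and this
      neighbourhood has, after averaging over w, at most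
      (1 + 2 rho_k / r_k) ^ d |G| <= (delta_k / 4) |G| room.  So at least
      (delta_k / 4) |G| of mass travels farther than rho_k.

    This is [level_bound].  Multiply it by 4 ^ (k + 1) and sum over k.  The
    oscillations add up to at most A d V ([multiscale_oscillation]): each one
    is dominated by its counterpart at one common tiny scale, and there the
    slices recompose |u (x + h) - u x|.  The transported masses add up to a
    multiple of W / A ^ 2, because sum of 4 ^ k over rho_k <= D is of order
    (D / A) ^ 2 ([far_sum]).  On the left stands the sum of
    (4 beta) ^ k |{u >= c_(k+1)}|, which dominates int (u - C)_+ ^ p up to a
    constant since beta ^ p = 4 beta ([excess_bound]).

    The variation enters only through int |u (x + h) - u x| dx <= |h| V
    ([variation_shift]).  By duality this asks for
    int u (x) (g (x - h) - g x) dx <= |h| V with |g| <= 1.  For smooth g it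
    follows from the definition of V, cutting h into N small steps whose Taylor
    remainders vanish as N grows.  The optimal g is a sign, which is
    approximated by smooth functions in a weighted L^1 space; the sets whose
    indicator can be approximated form a sigma-algebra containing the slabs
    x_i < q ([approximable_measurable]), so mollifiers are avoided. *)

(** * Translation invariance of Lebesgue measure *)

Section shift1.
Context {R : realType}.
Local Notation mu := (@lebesgue_measure R).

Lemma measurable_addrr (h : R) :
  measurable_fun [set: measurableTypeR R] (fun x : measurableTypeR R => x + h : measurableTypeR R).
Proof. exact: measurable_funD. Qed.

(** The translate has the same value as Lebesgue measure on half-open
    intervals, and these determine it. *)
Lemma lebesgue_measure_shift (h : R) (A : set R) : measurable A ->
  pushforward mu (fun x : R => x + h : measurableTypeR R) A = mu A.
Proof.
move=> mA; apply/esym.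
have mf := measurable_addrr h.
pose nu : {measure set (measurableTypeR R) -> \bar R} :=
  measure_function_pushforward__canonical__measure_function_Measure mu mf.
apply: (lebesgue_measure_unique (mu := nu)) => //= _ [[a b]] _ <-.
rewrite /nu/= /pushforward.
have -> : (fun x : R => x + h) @^-1` `]a, b] = `]a - h, b - h]%classic.
  by apply/seteqP; split=> x /=; rewrite !in_itv/= ltrBlDr lerBrDr.
rewrite !lebesgue_measure_itv/= !lte_fin ltrD2r; case: ifPn => // _.
by rewrite -!EFinD; congr EFin; ring.
Qed.

Lemma ge0_integral_shift1 (h : R) (D : set R) (f : R -> \bar R) :
  measurable D -> measurable_fun [set: R] f -> (forall x, 0 <= f x)%E ->
  (\int[mu]_(x in (fun x => x + h)%R @^-1` D) f (x + h)%R = \int[mu]_(x in D) f x)%E.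
Proof.
move=> mD mf f0.
have := ge0_integral_pushforward (measurable_addrr h) mu mD
  (measurable_funS measurableT (@subsetT _ _) mf) (fun x _ => f0 x).
move=> <-; apply: eq_measure_integral => [|? A mA _]; first exact: measurable_addrr.
exact: lebesgue_measure_shift.
Qed.
End shift1.

Section lebesgue_rV.
Context {R : realType}.
Local Notation mu := (@lebesgue_measure R).

(** Tonelli for the recursive construction of the measure: it is what makes
    induction on the dimension possible. *)
Lemma ge0_integral_rV_cons n (f : 'rV[R]_n.+1 -> \bar R) :
  measurable_fun [set: 'rV[R]_n.+1] f -> (forall x, 0 <= f x)%E ->
  (\int[lebesgue_rV n.+1]_x f x =
   \int[mu]_t \int[lebesgue_rV n]_v f (rV_cons (t, v)))%E.
Proof.
move=> mf f0.
have mfc : measurable_fun [set: measurableTypeR R * 'rV[R]_n] (f \o @rV_cons R n).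
  exact: measurableT_comp mf (@measurable_rV_cons R n).
have H := ge0_integral_pushforward (@measurable_rV_cons R n)
  (mu \x lebesgue_rV n)%E measurableT mf (fun x _ => f0 x).
rewrite (_ : (\int[lebesgue_rV n.+1]_x f x)%E =
  (\int[pushforward (mu \x lebesgue_rV n)%E (@rV_cons R n)]_y f y)%E)//.
rewrite H preimage_setT (@fubini_tonelli1 _ _ _ _ _ mu (lebesgue_rV n) _ mfc)//.
by move=> x; exact: f0.
Qed.

Lemma rV_cons_uncons n (x : 'rV[R]_n.+1) : rV_cons (rV_uncons x) = x.
Proof.
apply/rowP => i; rewrite /rV_cons /rV_uncons/= -[RHS](congr1 (fun y : 'rV_(1 + n) => y 0 i) (hsubmxK (x : 'rV[R]_(1 + n)))).
by congr (row_mx _ _ _ _); apply/rowP => j; rewrite !mxE; congr (x _ _); apply/val_inj; rewrite /= ord1.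
Qed.

Lemma rV_cons0 n (p : R * 'rV[R]_n) : rV_cons p 0 ord0 = p.1.
Proof. by have /(congr1 fst) := rV_consK p. Qed.

Lemma rV_consS n (p : R * 'rV[R]_n) (i : 'I_n) : rV_cons p 0 (lift ord0 i) = p.2 0 i.
Proof.
have /(congr1 (fun q : R * 'rV[R]_n => q.2 0 i)) := rV_consK p.
by rewrite /= mxE => <-; congr (fun_of_matrix _ _ _); apply/val_inj.
Qed.

Lemma rV_consD n (p q : R * 'rV[R]_n) :
  rV_cons p + rV_cons q = rV_cons (p.1 + q.1, p.2 + q.2).
Proof.
apply/rowP => i; rewrite mxE; case: (unliftP ord0 i) => [j ->|->].
  by rewrite !rV_consS mxE.
by rewrite !rV_cons0.
Qed.

Lemma measurable_shift n (h : 'rV[R]_n) :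
  measurable_fun [set: 'rV[R]_n] (fun x : 'rV[R]_n => x + h).
Proof.
apply: measurable_fun_rVP => i.
rewrite (_ : (fun x => _) = (fun x : 'rV[R]_n => x 0 i + h 0 i)); last first.
  by apply/funext => x; rewrite !mxE.
by apply: measurable_funD => //; exact: measurable_coor.
Qed.

(** Induction on the dimension: the first coordinate is shifted by the
    one-dimensional case, the others by the induction hypothesis. *)
Lemma ge0_integral_shift n (h : 'rV[R]_n) (f : 'rV[R]_n -> \bar R) :
  measurable_fun [set: 'rV[R]_n] f -> (forall x, 0 <= f x)%E ->
  (\int[lebesgue_rV n]_x f (x + h)%R = \int[lebesgue_rV n]_x f x)%E.
Proof.
elim: n h f => [h f mf f0|n IH h f mf f0].
  by apply: eq_integral => x _; rewrite (thinmx0 (x + h)) (thinmx0 x).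
rewrite (ge0_integral_rV_cons mf f0) (ge0_integral_rV_cons _ (fun x => f0 _)).
  2: exact: measurableT_comp mf (measurable_shift h).
pose F t := (\int[lebesgue_rV n]_v f (rV_cons (t, v)))%E.
have mfc : measurable_fun [set: measurableTypeR R * 'rV[R]_n] (f \o @rV_cons R n).
  exact: measurableT_comp mf (@measurable_rV_cons R n).
have mF : measurable_fun [set: R] F.
  exact: (@measurable_fun_fubini_tonelli_F _ _ _ _ _ (lebesgue_rV n) _ mfc (fun x => f0 _)).
rewrite -[RHS](ge0_integral_shift1 (rV_uncons h).1 measurableT mF); last first.
  by move=> x; apply: integral_ge0.
rewrite preimage_setT; apply: eq_integral => t _; rewrite /F.
rewrite -[RHS](IH (rV_uncons h).2)//; last first.
  exact: (measurableT_comp mfc (pair1_measurable _)).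
apply: eq_integral => v _.
by rewrite -{1}(rV_cons_uncons h) rV_consD.
Qed.

End lebesgue_rV.

(** * Integration over the torus *)

Section periodic1.
Context {R : realType}.
Local Notation mu := (@lebesgue_measure R).

Lemma periodic_int (T : Type) (L : R) (f : R -> T) (k : int) x :
  (forall y, f (y + L) = f y) -> f (x + L * k%:~R) = f x.
Proof.
move=> fL.
have P n y : f (y + L * n%:R) = f y.
  elim: n => [|n IH]; first by rewrite mulr0 addr0.
  by rewrite -natr1 mulrDr mulr1 addrA fL.
case: k => n; first exact: P.
by rewrite NegzE mulrNz mulrN -(P n.+1 (x - _)) subrK.
Qed.

(** After reducing h to a shift in [0, L[ by periodicity, the window
    [h, L + h[ is cut at L and its overhang [L, L + h[ moved back to
    [0, h[. *)
Lemma ge0_integral_periodic_shift (L h : R) (f : R -> \bar R) : 0 < L ->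
  measurable_fun [set: R] f -> (forall x, 0 <= f x)%E ->
  (forall x, f (x + L) = f x) ->
  (\int[mu]_(x in `[0%R, L]) f (x + h)%R = \int[mu]_(x in `[0%R, L]) f x)%E.
Proof.
move=> L0 mf f0 fL.
wlog /andP[h0 hL] : h / 0 <= h < L.
  move=> H; pose k := Num.floor (h / L).
  rewrite -[RHS](H (h - L * k%:~R)); last first.
    rewrite subr_ge0 ltrBlDl mulrC -ler_pdivlMr// floor_le_tmp/=.
    have := lt_succ_floor (h / L).
    by rewrite -/k ltr_pdivrMr// intrD mulrDl mul1r.
  apply: eq_integral => x _; rewrite -[RHS](periodic_int k _ fL).
  by congr f; ring.
have mfh : measurable_fun [set: R] (fun x : R => f (x + h)).
  exact: measurableT_comp mf (measurable_addrr h).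
have mS (A : set R) g : measurable_fun [set: R] g -> measurable_fun A (g : R -> \bar R).
  by move=> ?; apply: measurable_funS; last by eassumption.
have split (g : R -> \bar R) a b c : a <= b -> b <= c ->
    measurable_fun [set: R] g -> (forall x, 0 <= g x)%E ->
  (\int[mu]_(x in `[a, c[) g x =
    \int[mu]_(x in `[a, b[) g x + \int[mu]_(x in `[b, c[) g x)%E.
  move=> ab bc mg g0.
  rewrite (@itv_bndbnd_setU _ _ _ (BLeft b)) ?bnd_simp//.
  rewrite ge0_integral_setU//; first exact: mS.
  rewrite disj_set2E; apply/eqP; rewrite -subset0 => x [] /=.
  by rewrite !in_itv/= => /andP[_ xb] /andP[bx _]; move: (lt_le_trans xb bx); rewrite ltxx.
have shift (g : R -> \bar R) a b c : measurable_fun [set: R] g -> (forall x, 0 <= g x)%E ->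
  (\int[mu]_(x in `[a, b[) g (x + c)%R = \int[mu]_(x in `[(a + c)%R, (b + c)%R[) g x)%E.
  move=> mg g0; rewrite -(ge0_integral_shift1 c _ mg g0)//; congr (integral _ _ _).
  by apply/seteqP; split => x /=; rewrite !in_itv/= lerD2r ltrD2r.
rewrite -!integral_itv_bndo_bndc; [|exact: mS|exact: mS].
rewrite shift// add0r (split f h L)//; [|exact: ltW|lra].
rewrite (_ : `[L, (L + h)[ = `[(0 + L), (h + L)[)%classic; last by rewrite add0r addrC.
have -> : (\int[mu]_(x in `[(0 + L)%R, (h + L)%R[) f x =
    \int[mu]_(x in `[0%R, h[) f x)%E.
  by rewrite -shift//; apply: eq_integral => x _; exact: fL.
by rewrite addeC -split//; exact: ltW.
Qed.
End periodic1.

Section torus_facts.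
Context {R : realType}.
Local Notation mu := (@lebesgue_measure R).

Lemma cube_rV_cons n (L t : R) (v : 'rV[R]_n) :
  cube L (rV_cons (t, v)) <-> `[0, L]%classic t /\ cube L v.
Proof.
rewrite /= in_itv/=; split=> [H|[H0 H] i].
  split=> [|i]; first by have := H ord0; rewrite rV_cons0.
  by have := H (lift ord0 i); rewrite rV_consS.
by case: (unliftP ord0 i) => [j ->|->]; rewrite ?rV_cons0// rV_consS.
Qed.

Lemma lebesgue_cube n (L : R) : 0 <= L -> lebesgue_rV n (cube L) = (L ^+ n)%:E.
Proof.
move=> L0.
have V : mu `[0, L]%classic = L%:E.
  rewrite lebesgue_measure_itv/= lte_fin; case: ltrP => [_|L0'].
    by rewrite oppr0 adde0.
  by congr EFin; apply/eqP; rewrite eq_le L0 L0'.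
elim: n => [|n IH].
  by rewrite expr0 /= /dirac indicE mem_set//; case.
rewrite /= /lebesgue_cons /pushforward.
rewrite (_ : _ @^-1` _ = `[0, L]%classic `*` cube L); last first.
  by apply/seteqP; split => -[t v] /=; rewrite (cube_rV_cons L t v).
rewrite product_measure1E//; last exact: measurable_cube.
by rewrite IH [X in (X * _)%E]V -EFinM exprS.
Qed.

Lemma measurable_hyperplane n (i : 'I_n) (c : R) :
  measurable [set x : 'rV[R]_n | x 0 i = c].
Proof.
rewrite -[X in measurable X]setTI.
by have := @measurable_coor _ R n i measurableT [set c] (measurable_set1 c).
Qed.

Lemma lebesgue_hyperplane n (i : 'I_n) (c : R) :
  lebesgue_rV n [set x | x 0 i = c] = 0%E.
Proof.
have mH := measurable_hyperplane.
elim: n i => [[]//|n IH] i.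
rewrite /= /lebesgue_cons /pushforward.
case: (unliftP ord0 i) => [j|] ->.
  rewrite [X in (_ \x _)%E X](_ : _ = [set: measurableTypeR R] `*`
      [set x : 'rV[R]_n | x 0 (j : 'I_n) = c]); last first.
    by apply/seteqP; split => -[t v] /=; rewrite (rV_consS (t, v)) => //= -[].
  by rewrite product_measure1E//; [rewrite [X in (_ * X)%E](IH j) mule0|exact: mH].
rewrite [X in (_ \x _)%E X](_ : _ = [set c : measurableTypeR R] `*`
    [set: 'rV[R]_n]); last first.
  by apply/seteqP; split => -[t v] /=; rewrite (rV_cons0 (t, v)) => //= -[].
by rewrite product_measure1E// [X in (X * _)%E]lebesgue_measure_set1 mul0e.
Qed.

(** Restricting the measure or the domain of integration is the same, the
    complement of the cube being negligible. *)
Lemma torus_integralE n (L : R) (f : 'rV[R]_n -> \bar R) :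
  measurable_fun [set: 'rV[R]_n] f -> (forall x, 0 <= f x)%E ->
  (\int[torus_measure L]_x f x = \int[lebesgue_rV n]_(x in cube L) f x)%E.
Proof.
move=> mf f0; have mC := measurable_cube (n := n) L.
rewrite (ge0_negligible_integral (N := ~` cube L))//; first 1 last.
- exact: measurableC.
- by rewrite /= /torus_measure /mrestr setICl measure0.
rewrite setDE setTI setCK; apply: eq_measure_integral => A mA AC.
by rewrite /= /torus_measure /mrestr (setIidl AC).
Qed.

Lemma torus_measure_fin n (L : R) : fin_num_fun (@torus_measure R n L).
Proof.
move=> A mA; rewrite ge0_fin_numE//.
apply: (@le_lt_trans _ _ (lebesgue_rV n (cube `|L|))).
  rewrite /torus_measure /mrestr; apply: le_measure; rewrite ?inE.
  - by apply: measurableI => //; exact: measurable_cube.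
  - exact: measurable_cube.
  - move=> x [_ Cx] i; have /andP[-> xL] := Cx i.
    by rewrite (le_trans xL)// ler_norm.
by rewrite lebesgue_cube// ltry.
Qed.

HB.instance Definition _ n (L : R) := Measure_isFinite.Build _ _ _
  (@torus_measure R n L) (@torus_measure_fin n L).

Lemma torus_measureT n (L : R) : 0 <= L ->
  @torus_measure R n L setT = (L ^+ n)%:E.
Proof. by move=> L0; rewrite /torus_measure /mrestr setTI lebesgue_cube. Qed.

Lemma torus_hyperplane n (L : R) (i : 'I_n) (c : R) :
  @torus_measure R n L [set x | x 0 i = c] = 0%E.
Proof.
apply/eqP; rewrite eq_le measure_ge0 andbT.
rewrite -(lebesgue_hyperplane i c) /torus_measure /mrestr.
apply: le_measure; rewrite ?inE; last exact: subIsetl.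
- by apply: measurableI; [exact: measurable_hyperplane|exact: measurable_cube].
- exact: measurable_hyperplane.
Qed.

Lemma ge0_torus_integral_cons n (L : R) (f : 'rV[R]_n.+1 -> \bar R) :
  measurable_fun [set: 'rV[R]_n.+1] f -> (forall x, 0 <= f x)%E ->
  (\int[torus_measure L]_x f x =
   \int[mu]_(t in `[0%R, L]) \int[torus_measure L]_v f (rV_cons (t, v)))%E.
Proof.
move=> mf f0; have mC m := measurable_cube (n := m) L.
rewrite torus_integralE// integral_mkcond ge0_integral_rV_cons; first 1 last.
- by apply/(measurable_restrictT _ (mC _)); exact: measurable_funS mf.
- exact: erestrict_ge0.
rewrite [RHS]integral_mkcond; apply: eq_integral => t _.
rewrite patchE; case: ifPn => [|]; rewrite ?inE ?notin_setE => tL.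
  rewrite torus_integralE//; last first.
    exact: (measurableT_comp (measurableT_comp mf (@measurable_rV_cons R n)) (pair1_measurable _)).
  rewrite [RHS]integral_mkcond; apply: eq_integral => v _.
  rewrite !patchE; congr (if _ then _ else _); apply/idP/idP; rewrite !inE.
    by move=> /cube_rV_cons[].
  by move=> vL; apply/cube_rV_cons.
rewrite integral0_eq// => v _; rewrite patchE ifF//; apply/negP.
by rewrite inE => /cube_rV_cons[].
Qed.

Lemma measurable_torus_section n (L : R) (f : 'rV[R]_n.+1 -> \bar R) :
  measurable_fun [set: 'rV[R]_n.+1] f -> (forall x, 0 <= f x)%E ->
  measurable_fun [set: R]
    (fun t => \int[torus_measure L]_v f (rV_cons (t, v)))%E.
Proof.
move=> mf f0.
exact: (@measurable_fun_fubini_tonelli_F _ _ _ _ _ (@torus_measure R n L) _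
  (measurableT_comp mf (@measurable_rV_cons R n)) (fun x => f0 _)).
Qed.

Lemma scale_deltaE n (L : R) (i j : 'I_n) :
  (L *: delta_mx 0 i : 'rV[R]_n) 0 j = L * (j == i)%:R.
Proof. by rewrite !mxE. Qed.

(** The change of variables used throughout: on the torus a translation
    costs nothing, although it does not preserve the fundamental domain.  The
    proof is an induction on the dimension in which the partial integral over
    the last coordinates is itself a periodic function of the first. *)
Lemma ge0_torus_integral_shift n (L : R) (h : 'rV[R]_n)
    (f : 'rV[R]_n -> \bar R) : 0 < L ->
  measurable_fun [set: 'rV[R]_n] f -> (forall x, 0 <= f x)%E ->
  lattice_periodic L f ->
  (\int[torus_measure L]_x f (x + h)%R = \int[torus_measure L]_x f x)%E.
Proof.
move=> L0; elim: n h f => [h f mf f0 fL|n IH h f mf f0 fL].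
  by apply: eq_integral => x _; rewrite (thinmx0 (x + h)) (thinmx0 x).
rewrite (ge0_torus_integral_cons _ mf f0).
rewrite (ge0_torus_integral_cons _ _ (fun x => f0 _)).
  2: exact: measurableT_comp mf (measurable_shift h).
pose F t := (\int[torus_measure L]_v f (rV_cons (t, v)))%E.
have mF : measurable_fun [set: R] F by exact: measurable_torus_section.
have F0 t : (0 <= F t)%E by exact: integral_ge0.
have FL t : F (t + L) = F t.
  apply: eq_integral => v _; rewrite -[RHS](fL ord0); congr f.
  apply/rowP => i; rewrite [RHS]mxE scale_deltaE.
  case: (unliftP ord0 i) => [j ->|->].
    by rewrite !rV_consS/= mulr0 addr0.
  by rewrite !rV_cons0/= mulr1.
rewrite -[RHS](ge0_integral_periodic_shift (rV_uncons h).1 L0 mF F0 FL).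
apply: eq_integral => t _; rewrite /F -[RHS](IH (rV_uncons h).2)//.
- by apply: eq_integral => v _; rewrite -{1}(rV_cons_uncons h) rV_consD.
- exact: (measurableT_comp (measurableT_comp mf (@measurable_rV_cons R n)) (pair1_measurable _)).
- move=> i v; rewrite -[RHS](fL (lift ord0 i)); congr f.
  apply/rowP => j; rewrite [RHS]mxE scale_deltaE.
  case: (unliftP ord0 j) => [k ->|->].
    by rewrite !rV_consS/= [LHS]mxE scale_deltaE (inj_eq (@lift_inj _ _)).
  by rewrite !rV_cons0/= mulr0 addr0.
Qed.

End torus_facts.

(** * Periodic functions with Lipschitz gradient *)

Section c11.
Context {R : realType} {n : nat}.
Implicit Types (L M : R) (g : 'rV[R]_n -> R) (G : 'rV[R]_n -> 'rV[R]_n).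

Definition dotv (a b : 'rV[R]_n) : R := \sum_i a 0 i * b 0 i.

Lemma dotvDl a b c : dotv (a + b) c = dotv a c + dotv b c.
Proof. by rewrite /dotv -big_split; apply: eq_bigr => i _; rewrite mxE mulrDl. Qed.

Lemma dotvZl k a c : dotv (k *: a) c = k * dotv a c.
Proof. by rewrite /dotv mulr_sumr; apply: eq_bigr => i _; rewrite mxE mulrA. Qed.

Lemma dotv0l c : dotv 0 c = 0.
Proof. by rewrite /dotv big1// => i _; rewrite mxE mul0r. Qed.

Lemma dotv_delta a i : dotv a (delta_mx 0 i) = a 0 i.
Proof.
rewrite /dotv (bigD1 i)//= mxE !eqxx mulr1 big1 ?addr0// => j ji.
by rewrite mxE (negbTE ji) andbF mulr0.
Qed.

Lemma ler_coord_norm (x : 'rV[R]_n) i : `|x 0 i| <= `|x|.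
Proof.
rewrite [leRHS]mx_normrE; exact: (le_bigmax _ (fun i : 'I_1 * 'I_n => `|x i.1 i.2|) (0, i)).
Qed.

Lemma ler_norm_coord (x : 'rV[R]_n) c : 0 <= c -> (forall i, `|x 0 i| <= c) -> `|x| <= c.
Proof.
move=> c0 H; rewrite [leLHS]mx_normrE; apply: bigmax_le => // -[i j] _ /=.
by rewrite ord1.
Qed.

(** One constant M bounds g, its gradient G, the Lipschitz constant of G and
    the quadratic Taylor remainder.  Keeping the remainder as a pointwise
    inequality makes closure under sums, products and squared positive parts
    elementary algebra, and is all that is needed to recover the derivative.
    The norm is the sup norm; the discrepancy with the Euclidean norm is
    absorbed in M. *)
Record c11 L M g G : Prop := C11 {
  c11_mfun : measurable_fun [set: 'rV[R]_n] g ;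
  c11_mgrad : forall i, measurable_fun [set: 'rV[R]_n] (fun x => G x 0 i) ;
  c11_per : lattice_periodic L g ;
  c11_pgrad : lattice_periodic L G ;
  c11_ge0 : 0 <= M ;
  c11_bnd : forall x, `|g x| <= M ;
  c11_bgrad : forall x s, `|dotv (G x) s| <= M * `|s| ;
  c11_lgrad : forall x y s, `|dotv (G y) s - dotv (G x) s| <= M * `|y - x| * `|s| ;
  c11_rem : forall x s, `|g (x + s) - g x - dotv (G x) s| <= M * `|s| ^+ 2 }.

Lemma c11_weaken L M M' g G : M <= M' -> c11 L M g G -> c11 L M' g G.
Proof.
move=> MM' [mg mG pg pG M0 b bG lG r]; split => //.
- exact: le_trans MM'.
- by move=> x; apply: le_trans MM'.
- by move=> x s; apply: le_trans (bG x s) _; rewrite ler_wpM2r.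
- by move=> x y s; apply: le_trans (lG x y s) _; rewrite -!mulrA ler_wpM2r// mulr_ge0.
- by move=> x s; apply: le_trans (r x s) _; rewrite ler_wpM2r// sqr_ge0.
Qed.

Lemma normrM_le (a b A B : R) : `|a| <= A -> `|b| <= B -> `|a * b| <= A * B.
Proof. by move=> aA bB; rewrite normrM ler_pM. Qed.

(** For small increments the remainder is dominated by its linear bound; for
    increments larger than 1 boundedness is enough. *)
Lemma c11_lip L M g G x y : c11 L M g G -> `|g y - g x| <= 2 * M * `|y - x|.
Proof.
move=> [_ _ _ _ M0 b bG _ r]; set s := y - x.
have [s1|s1] := leP `|s| 1.
  rewrite (_ : g y - g x = (g (x + s) - g x - dotv (G x) s) + dotv (G x) s); last first.
    by rewrite /s addrCA subrr addr0 subrK.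
  apply: le_trans (ler_normD _ _) _.
  have := r x s; have := bG x s.
  have : M * `|s| ^+ 2 <= M * `|s| by rewrite ler_wpM2l// expr2 ler_piMl.
  set a := `|_ - _ - _|; set c := `|dotv _ _|; lra.
apply: le_trans (ler_normB _ _) _; have := b x; have := b y.
have : M <= M * `|s| by rewrite ler_peMr// ltW.
set a := `|g y|; set c := `|g x|; lra.
Qed.

Lemma c11_cst L (c : R) : c11 L `|c| (cst c) (cst 0).
Proof.
split=> //.
- by move=> x s; rewrite dotv0l normr0 mulr_ge0.
- by move=> x y s; rewrite !dotv0l subrr normr0 !mulr_ge0.
- by move=> x s; rewrite dotv0l !subrr normr0 mulr_ge0// sqr_ge0.
Qed.

Lemma c11_add L M g G h H : c11 L M g G -> c11 L M h H ->
  c11 L (2 * M) (fun x => g x + h x) (fun x => G x + H x).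
Proof.
move=> [mg mG pg pG M0 b bG lG r] [mh mH ph pH _ b' bH lH r']; split.
- exact: measurable_funD.
- move=> i; rewrite (_ : (fun x => _) = (fun x => G x 0 i + H x 0 i)).
    exact: measurable_funD.
  by apply/funext => x; rewrite mxE.
- by move=> i x; rewrite pg ph.
- by move=> i x; rewrite pG pH.
- by rewrite mulr_ge0.
- move=> x; apply: le_trans (ler_normD _ _) _; have := b x; have := b' x; lra.
- move=> x s; rewrite dotvDl; apply: le_trans (ler_normD _ _) _.
  have := bG x s; have := bH x s; lra.
- move=> x y s; rewrite !dotvDl opprD addrACA; apply: le_trans (ler_normD _ _) _.
  have := lG x y s; have := lH x y s; lra.
- move=> x s; rewrite dotvDl.
  rewrite (_ : _ - _ = (g (x + s) - g x - dotv (G x) s) + (h (x + s) - h x - dotv (H x) s)); last by ring.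
  apply: le_trans (ler_normD _ _) _.
  have := r x s; have := r' x s; lra.
Qed.

(** The remainder of a product splits as
    (remainder of g) h + (dg s) (h (x + s) - h x) + g (remainder of h). *)
Lemma c11_mul L M g G h H : c11 L M g G -> c11 L M h H ->
  c11 L (6 * M ^+ 2) (fun x => g x * h x) (fun x => g x *: H x + h x *: G x).
Proof.
move=> Cg Ch; have lipg x y := c11_lip x y Cg; have liph x y := c11_lip x y Ch.
case: Cg => [mg mG pg pG M0 b bG lG r]; case: Ch => [mh mH ph pH _ b' bH lH r'].
split.
- exact: measurable_funM.
- move=> i; rewrite (_ : (fun x => _) = (fun x => g x * H x 0 i + h x * G x 0 i)).
    by apply: measurable_funD; exact: measurable_funM.
  by apply/funext => x; rewrite !mxE.
- by move=> i x; rewrite pg ph.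
- by move=> i x; rewrite pG pH pg ph.
- by rewrite mulr_ge0// sqr_ge0.
- move=> x; apply: le_trans (normrM_le (b x) (b' x)) _; rewrite -expr2.
  by rewrite ler_peMl ?sqr_ge0// ler1n.
- move=> x s; rewrite dotvDl !dotvZl; apply: le_trans (ler_normD _ _) _.
  have := normrM_le (b x) (bH x s); have := normrM_le (b' x) (bG x s).
  have : 0 <= M * (M * `|s|) by rewrite !mulr_ge0.
  set a := `|g x * _|; set c := `|h x * _|; lra.
- move=> x y s; rewrite !dotvDl !dotvZl.
  have E1 := normrM_le (lipg x y) (bH y s); have E2 := normrM_le (b x) (lH x y s).
  have E3 := normrM_le (liph x y) (bG y s); have E4 := normrM_le (b' x) (lG x y s).
  rewrite (_ : _ - _ = ((g y - g x) * dotv (H y) s + g x * (dotv (H y) s - dotv (H x) s))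
    + ((h y - h x) * dotv (G y) s + h x * (dotv (G y) s - dotv (G x) s))); last by ring.
  apply: le_trans (ler_normD _ _) _.
  apply: le_trans (lerD (ler_normD _ _) (ler_normD _ _)) _.
  apply: le_trans (lerD (lerD E1 E2) (lerD E3 E4)) _.
  by rewrite le_eqVlt; apply/orP; left; apply/eqP; ring.
- move=> x s; rewrite dotvDl !dotvZl.
  have E1 := normrM_le (r x s) (b' (x + s)).
  have E2 := normrM_le (bG x s) (liph x (x + s)).
  have E3 := normrM_le (b x) (r' x s).
  rewrite (_ : _ - _ = (g (x + s) - g x - dotv (G x) s) * h (x + s) +
    dotv (G x) s * (h (x + s) - h x) + g x * (h (x + s) - h x - dotv (H x) s)); last by ring.
  apply: le_trans (ler_normD _ _) _.
  apply: le_trans (lerD (ler_normD _ _) E3) _.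
  apply: le_trans (lerD (lerD E1 E2) (lexx _)) _.
  rewrite (addrAC x) subrr add0r.
  have : 0 <= M * (M * `|s| ^+ 2) by rewrite !mulr_ge0// sqr_ge0.
  rewrite !expr2; set z := `|s|; lra.
Qed.

(** The square of the positive part has a Lipschitz derivative, unlike the
    positive part itself: this is why cut-offs are built with it. *)
Lemma sqr_pospart_rem (a e : R) :
  `|Num.max (a + e) 0 ^+ 2 - Num.max a 0 ^+ 2 - 2 * Num.max a 0 * e| <= e ^+ 2.
Proof.
by rewrite ler_norml; apply/andP; case: (leP (a + e) 0) => ?; case: (leP a 0) => ?; split; nra.
Qed.

Lemma pospart_lip (a b : R) : `|Num.max b 0 - Num.max a 0| <= `|b - a|.
Proof.
case: (leP b 0) => ?; case: (leP a 0) => ?; rewrite ?subrr ?normr0//.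
- by rewrite ler0_norm ?ler0_norm; lra.
- by rewrite ger0_norm ?ger0_norm; lra.
Qed.

Lemma c11_sqr_pospart L M g G : c11 L M g G ->
  c11 L (10 * M ^+ 2 + M) (fun x => Num.max (g x) 0 ^+ 2)
    (fun x => (2 * Num.max (g x) 0) *: G x).
Proof.
move=> Cg; have lipg x y := c11_lip x y Cg.
case: Cg => [mg mG pg pG M0 b bG lG r].
have mm : measurable_fun [set: 'rV[R]_n] (fun x => Num.max (g x) 0).
  by apply: measurable_maxr.
have M20 : 0 <= M ^+ 2 by rewrite sqr_ge0.
have bm x : `|Num.max (g x) 0| <= M.
  have := pospart_lip 0 (g x); rewrite maxxx !subr0 => /le_trans; exact.
have b2m x : `|2 * Num.max (g x) 0| <= 2 * M.
  by rewrite normrM (ger0_norm (ler0n _ 2)) ler_wpM2l.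
split.
- exact: measurable_funX.
- move=> i; rewrite (_ : (fun x => _) = (fun x => (2 * Num.max (g x) 0) * G x 0 i)).
    by apply: measurable_funM => //; exact: measurable_funM.
  by apply/funext => x; rewrite !mxE.
- by move=> i x; rewrite pg.
- by move=> i x; rewrite pG pg.
- by rewrite addr_ge0// mulr_ge0.
- move=> x; rewrite expr2; apply: le_trans (normrM_le (bm x) (bm x)) _; nra.
- move=> x s; rewrite dotvZl; apply: le_trans (normrM_le (b2m x) (bG x s)) _.
  have : 0 <= M * `|s| by rewrite mulr_ge0.
  have : 0 <= M ^+ 2 * `|s| by rewrite mulr_ge0.
  by rewrite !expr2; lra.
- move=> x y s; rewrite !dotvZl.
  have B : `|2 * Num.max (g y) 0 - 2 * Num.max (g x) 0| <= 4 * M * `|y - x|.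
    rewrite -mulrBr normrM (ger0_norm (ler0n _ 2)).
    have := le_trans (pospart_lip (g x) (g y)) (lipg x y); lra.
  have E1 := normrM_le B (bG y s); have E2 := normrM_le (b2m x) (lG x y s).
  rewrite (_ : _ - _ = (2 * Num.max (g y) 0 - 2 * Num.max (g x) 0) * dotv (G y) s
     + 2 * Num.max (g x) 0 * (dotv (G y) s - dotv (G x) s)); last by ring.
  apply: le_trans (ler_normD _ _) _; apply: le_trans (lerD E1 E2) _.
  have : 0 <= M ^+ 2 * `|y - x| * `|s| by rewrite !mulr_ge0.
  have : 0 <= M * `|y - x| * `|s| by rewrite !mulr_ge0.
  by rewrite !expr2; lra.
- move=> x s; rewrite dotvZl; set e := g (x + s) - g x.
  have -> : g (x + s) = g x + e by rewrite /e; ring.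
  have E1 := sqr_pospart_rem (g x) e; have E2 := normrM_le (b2m x) (r x s).
  rewrite (_ : _ - _ = (Num.max (g x + e) 0 ^+ 2 - Num.max (g x) 0 ^+ 2 - 2 * Num.max (g x) 0 * e)
     + 2 * Num.max (g x) 0 * (e - dotv (G x) s)); last by ring.
  apply: le_trans (ler_normD _ _) _; apply: le_trans (lerD E1 E2) _.
  have : e ^+ 2 <= (2 * M * `|s|) ^+ 2.
    rewrite -(real_normK (num_real e)) lerXn2r ?nnegrE ?mulr_ge0//.
    by rewrite /e (le_trans (lipg x (x + s)))// (addrAC x) subrr add0r.
  have : 0 <= M ^+ 2 * `|s| ^+ 2 by rewrite mulr_ge0 ?sqr_ge0.
  have : 0 <= M * `|s| ^+ 2 by rewrite mulr_ge0 ?sqr_ge0.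
  by rewrite !expr2; lra.
Qed.

End c11.

Section trig.
Context {R : realType}.

Lemma normr_sin_le (x : R) : `|sin x| <= `|x|.
Proof.
wlog x0 : x / 0 < x.
  move=> H; case: (ltgtP x 0) => [x0|x0|->]; [|exact: H|by rewrite sin0 normr0].
  by rewrite -normrN -sinN -[leRHS]normrN; apply: H; rewrite oppr_gt0.
have [c _] := MVT x0 (fun y _ => is_derive_sin y) (continuous_subspaceT (@continuous_sin R)).
by rewrite sin0 !subr0 => ->; rewrite normrM ler_piMl// cos_max.
Qed.

Lemma normr_cosB1_le (x : R) : `|cos x - 1| <= `|x|.
Proof.
wlog x0 : x / 0 < x.
  move=> H; case: (ltgtP x 0) => [x0|x0|->]; [|exact: H|by rewrite cos0 subrr normr0].
  by rewrite -(cosN x) -[leRHS]normrN; apply: H; rewrite oppr_gt0.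
have [c _] := MVT x0 (fun y _ => is_derive_cos y) (continuous_subspaceT (@continuous_cos R)).
by rewrite cos0 !subr0 => ->; rewrite normrM normrN ler_piMl// sin_max.
Qed.

Lemma normr_cosB1_le_sqr (x : R) : `|cos x - 1| <= x ^+ 2.
Proof.
have -> : cos x - 1 = - (sin (x / 2) ^+ 2 *+ 2).
  by rewrite {1}(_ : x = (x / 2) *+ 2) ?cos_mulr2n ?cos2sin2 ?mulrnBl; [ring|field].
rewrite normrN ger0_norm; last by rewrite mulrn_wge0// sqr_ge0.
have : sin (x / 2) ^+ 2 <= (x / 2) ^+ 2.
  by rewrite -(real_normK (num_real (sin _))) -(real_normK (num_real (x / 2)))
    lerXn2r ?nnegrE// normr_sin_le.
have -> : (x / 2) ^+ 2 = x ^+ 2 / 4 by field.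
rewrite -mulr_natl; have := sqr_ge0 x; set s := sin _ ^+ 2; set y := x ^+ 2; lra.
Qed.

Lemma normr_sinB_le (x : R) : `|sin x - x| <= x ^+ 2.
Proof.
wlog x0 : x / 0 < x.
  move=> H; case: (ltgtP x 0) => [x0|x0|->]; [|exact: H|by rewrite sin0 subrr normr0 expr0n].
  have := H (- x); rewrite oppr_gt0 sinN sqrrN -opprD normrN => ->//.
have D (y : R) : y \in `]0, x[ -> is_derive y 1 (sin - id) (cos y - 1).
  by move=> _; apply: is_deriveB.
have C : {within `[0, x], continuous (sin - id : R -> R)}.
  apply: continuous_subspaceT => y; apply: cvgB; [exact: continuous_sin|exact: cvg_id].
have [c cx] := MVT x0 D C.
rewrite -![(sin - id) _]/(sin _ - _) sin0 !subr0 => ->.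
rewrite normrM expr2 (ger0_norm (ltW x0)) ler_wpM2r ?(ltW x0)//.
apply: le_trans (normr_cosB1_le c) _.
by move: cx; rewrite in_itv/= => /andP[c0 cx]; rewrite ger0_norm ltW.
Qed.

(** Addition formula, then second order bounds for cos and sin at 0. *)
Lemma cos_rem (a e : R) : `|cos (a + e) - cos a + sin a * e| <= 2 * e ^+ 2.
Proof.
rewrite [X in `|X|](_ : _ = cos a * (cos e - 1) + - sin a * (sin e - e)); last by rewrite cosD; ring.
apply: le_trans (ler_normD _ _) _.
have := normrM_le (cos_max a) (normr_cosB1_le_sqr e).
have := @normrM_le _ (- sin a) (sin e - e) 1 (e ^+ 2).
rewrite normrN => /(_ (sin_max a) (normr_sinB_le e)).
rewrite !mul1r => H1 H2; lra.
Qed.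

Lemma sin_lip (a b : R) : `|sin b - sin a| <= 2 * `|b - a|.
Proof.
set e := b - a; rewrite (_ : b = a + e); last by rewrite /e; ring.
rewrite [X in `|X|](_ : _ = sin a * (cos e - 1) + cos a * sin e); last by rewrite sinD; ring.
apply: le_trans (ler_normD _ _) _.
have := normrM_le (sin_max a) (normr_cosB1_le e).
have := normrM_le (cos_max a) (normr_sin_le e).
rewrite !mul1r => H1 H2; lra.
Qed.

(** The only concrete periodic functions required; all others are obtained
    from these by algebra and squared positive parts. *)
Lemma c11_cos n (L c : R) (i : 'I_n) : 0 < L ->
  let k := 2 * pi / L in
  c11 L (1 + k + 2 * k ^+ 2) (fun x : 'rV[R]_n => cos (k * x 0 i - c))
    (fun x => (- (k * sin (k * x 0 i - c))) *: delta_mx 0 i).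
Proof.
move=> L0 k; have k0 : 0 < k by rewrite /k divr_gt0// mulr_gt0// pi_gt0.
have k20 : 0 <= k ^+ 2 by rewrite sqr_ge0.
have ms : measurable_fun [set: 'rV[R]_n] (fun x : 'rV[R]_n => k * x 0 i - c).
  apply: measurable_funB => //; apply: measurable_funM => //.
  exact: measurable_coor.
have dE (a : R) (s : 'rV[R]_n) : dotv (a *: delta_mx 0 i) s = a * s 0 i.
  rewrite dotvZl -[in RHS](dotv_delta s i) /dotv; congr (_ * _).
  by apply: eq_bigr => j _; rewrite mulrC.
have per (x : 'rV[R]_n) j : k * (x + L *: delta_mx 0 j) 0 i - c =
    k * x 0 i - c + (pi *+ 2) * (i == j)%:R.
  rewrite !mxE eqxx/= /k mulr2n; field; rewrite gt_eqF//.
have perf (f : R -> R) j : periodic f (pi *+ 2) -> forall a, f (a + (pi *+ 2) * (i == j)%:R) = f a.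
  by move=> pf a; case: eqP => _; rewrite ?mulr1 ?mulr0 ?addr0.
have co (s : 'rV[R]_n) := ler_coord_norm s i.
split.
- exact: (measurableT_comp (continuous_measurable_fun (@continuous_cos R)) ms).
- move=> j; rewrite (_ : (fun x => _) =
      (fun x : 'rV[R]_n => - (k * sin (k * x 0 i - c)) * (j == i)%:R)); last first.
    by apply/funext => x; rewrite !mxE.
  apply: measurable_funM => //; apply: measurableT_comp => //.
  apply: measurable_funM => //.
  exact: (measurableT_comp (continuous_measurable_fun (@continuous_sin R)) ms).
- by move=> j x; rewrite per perf//; exact: cosD2pi.
- by move=> j x; rewrite per perf//; exact: sinD2pi.
- lra.
- move=> x; apply: le_trans (cos_max _) _; lra.
- move=> x s; rewrite dE; apply: (@le_trans _ _ (k * `|s|)).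
    apply: normrM_le => //; rewrite normrN normrM (gtr0_norm k0) ler_piMr ?(ltW k0)//.
    exact: sin_max.
  by rewrite ler_wpM2r//; lra.
- move=> x y s; rewrite !dE -mulrBl; apply: (@le_trans _ _ (2 * k ^+ 2 * `|y - x| * `|s|)).
    apply: normrM_le => //.
    rewrite (_ : _ - _ = - (k * (sin (k * y 0 i - c) - sin (k * x 0 i - c)))); last by ring.
    rewrite normrN normrM (gtr0_norm k0).
    apply: (@le_trans _ _ (k * (2 * (k * `|y - x|)))); last by rewrite le_eqVlt; apply/orP; left; apply/eqP; ring.
    rewrite ler_wpM2l ?(ltW k0)//; apply: le_trans (sin_lip _ _) _.
    rewrite ler_wpM2l// (_ : _ - _ = k * (y - x) 0 i); last by rewrite !mxE; ring.
    by rewrite normrM (gtr0_norm k0) ler_wpM2l ?(ltW k0)// ler_coord_norm.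
  by rewrite !ler_wpM2r//; lra.
- move=> x s; rewrite dE (_ : k * (x + s) 0 i - c = (k * x 0 i - c) + k * s 0 i); last first.
    by rewrite !mxE; ring.
  set a := k * x 0 i - c.
  rewrite (_ : _ - _ = cos (a + k * s 0 i) - cos a + sin a * (k * s 0 i)); last by ring.
  apply: le_trans (cos_rem _ _) _; apply: (@le_trans _ _ (2 * k ^+ 2 * `|s| ^+ 2)).
    rewrite -mulrA exprMn ler_wpM2l// ler_wpM2l// -(real_normK (num_real (s 0 i))).
    by rewrite lerXn2r ?nnegrE.
  by rewrite ler_wpM2r ?sqr_ge0//; lra.
Qed.

End trig.

(** * Density of smooth periodic functions *)

Section density.
Context {R : realType} {n : nat} (L : R).
Local Notation T := ('rV[R]_n).
Local Notation mu := (@torus_measure R n L).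

Definition test_fun (g : T -> R) := exists M G, c11 L M g G.

Lemma test_fun2 g h : test_fun g -> test_fun h ->
  exists M G H, c11 L M g G /\ c11 L M h H.
Proof.
move=> [M [G Cg]] [M' [H Ch]]; exists (Num.max M M'), G, H.
by split; [apply: c11_weaken Cg|apply: c11_weaken Ch]; rewrite le_max lexx ?orbT.
Qed.

Lemma test_cst c : test_fun (cst c).
Proof. by exists `|c|, (cst 0); exact: c11_cst. Qed.

Lemma test_add g h : test_fun g -> test_fun h -> test_fun (fun x => g x + h x).
Proof.
move=> /test_fun2 /[apply] -[M [G [H [Cg Ch]]]].
by exists (2 * M), (fun x => G x + H x); exact: c11_add.
Qed.

Lemma test_mul g h : test_fun g -> test_fun h -> test_fun (fun x => g x * h x).
Proof.
move=> /test_fun2 /[apply] -[M [G [H [Cg Ch]]]].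
by exists (6 * M ^+ 2), (fun x => g x *: H x + h x *: G x); exact: c11_mul.
Qed.

Lemma test_1B g : test_fun g -> test_fun (fun x => 1 - g x).
Proof.
move=> tg; rewrite (_ : (fun x => _) = (fun x => cst 1 x + cst (-1) x * g x)).
  by apply: test_add; [exact: test_cst|apply: test_mul => //; exact: test_cst].
by apply/funext => x /=; rewrite mulN1r.
Qed.

Lemma test_exp g N : test_fun g -> test_fun (fun x => g x ^+ N).
Proof.
move=> tg; elim: N => [|N IH]; first exact: test_cst.
rewrite (_ : (fun x => _) = (fun x => g x * g x ^+ N)); first exact: test_mul.
by apply/funext => x; rewrite exprS.
Qed.

(** With t = pi x_i / L and a = pi q / L, the function sin t * sin (a - t) is
    positive exactly for 0 < t < a.  It is the periodic function
    (cos (2 t - a) - cos a) / 2, and its squared positive part is regular. *)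
Lemma test_slab (i : 'I_n) (q : R) : 0 < q <= L -> exists b,
  [/\ test_fun b, forall x, 0 <= b x <= 1 &
      forall x, cube L x -> (0 < b x) = (0 < x 0 i < q)].
Proof.
move=> /andP[q0 qL]; have L0 : 0 < L by exact: lt_le_trans qL.
pose a := pi * q / L.
pose f (x : T) := 2^-1 * (cos (2 * pi / L * x 0 i - a) - cos a).
have fE x : f x = sin (pi * x 0 i / L) * sin (a - pi * x 0 i / L).
  rewrite /f; set t := pi * x 0 i / L.
  have -> : 2 * pi / L * x 0 i - a = t - (a - t).
    by rewrite /t; field; rewrite gt_eqF.
  have -> : cos a = cos (t + (a - t)) by congr cos; ring.
  by move: (a - t) => s; rewrite cosB cosD; set c := cos t * _; set d := sin t * _; lra.
have f1 x : `|f x| <= 1.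
  rewrite /f normrM ger0_norm//.
  have := ler_normB (cos (2 * pi / L * x 0 i - a)) (cos a).
  have := cos_max a; have := cos_max (2 * pi / L * x 0 i - a).
  set u := `|_ - _|; set v := `|cos _|; set w := `|cos a|; lra.
exists (fun x => Num.max (f x) 0 ^+ 2); split.
- have [M [G Cf]] : test_fun f.
    apply: test_mul; first exact: (test_cst 2^-1).
    apply: test_add; last exact: (test_cst (- cos a)).
    by do 2 eexists; exact: (c11_cos a i L0).
  by do 2 eexists; exact: c11_sqr_pospart Cf.
- move=> x; rewrite sqr_ge0/= expr_le1 ?le_max ?lexx ?orbT//.
  by rewrite ge_max ler01 andbT (le_trans (ler_norm _) (f1 x)).
move=> x /(_ i)/andP[x0 xL].
rewrite (_ : (0 < _) = (0 < f x)); last first.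
  rewrite exprn_even_gt0//=; apply/idP/idP; last by move=> fx; rewrite gt_eqF// lt_max fx.
  by case: ltP => //; rewrite eqxx.
rewrite fE; set t := pi * x 0 i / L.
have pi0 := pi_gt0 R.
have t0 : 0 <= t by rewrite /t divr_ge0 ?mulr_ge0 ?(ltW pi0) ?(ltW L0).
have tpi : t <= pi by rewrite /t ler_pdivrMr// ler_pM2l.
have apos : 0 < a by rewrite /a divr_gt0 ?mulr_gt0.
have api : a <= pi by rewrite /a ler_pdivrMr// ler_pM2l.
have xq : (x 0 i < q) = (t < a) by rewrite /t /a ltr_pM2r ?invr_gt0// ltr_pM2l.
have xp : (0 < x 0 i) = (0 < t) by rewrite /t pmulr_lgt0 ?invr_gt0// pmulr_rgt0.
rewrite xq xp; apply/idP/idP => [|/andP[tp ta]].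
- move: t0; rewrite le_eqVlt => /predU1P[<-|tp]; first by rewrite sin0 mul0r ltxx.
  rewrite tp/= => H; have [//|ta] := ltP t a; move: H.
  have : 0 <= sin t by rewrite sin_ge0_pi// (ltW tp).
  have : 0 <= sin (t - a) by rewrite sin_ge0_pi//; lra.
  by rewrite -(opprB t a) sinN => ? ?; nra.
- by rewrite mulr_gt0// sin_gt0_pi//; lra.
Qed.

Variable v : T -> R.
Hypothesis v0 : forall x, 0 <= v x.
Hypothesis iv : mu.-integrable setT (EFin \o v).

Let mv : measurable_fun [set: T] v.
Proof. by apply/measurable_EFinP; exact: measurable_int iv. Qed.

(** Approximation in L^1 with weight v; test functions are kept in [0, 1] so
    that products stay under control and signs 2 g - 1 stay admissible for the
    total variation. *)
Definition approximable (phi : T -> R) := [/\ measurable_fun [set: T] phi,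
  forall x, 0 <= phi x <= 1 &
  forall e, 0 < e -> exists g, [/\ test_fun g, forall x, 0 <= g x <= 1 &
    (\int[mu]_x (`|phi x - g x| * v x)%:E <= e%:E)%E]].

Lemma test_approximable g : test_fun g -> (forall x, 0 <= g x <= 1) ->
  approximable g.
Proof.
move=> tg g01; split=> //; first by case: tg => M [G []].
move=> e e0; exists g; split => //.
by rewrite integral0_eq ?lee_fin ?(ltW e0)// => x _; rewrite subrr normr0 mul0r.
Qed.

Lemma approximable_1B phi : approximable phi -> approximable (fun x => 1 - phi x).
Proof.
move=> [mphi phi01 H]; split.
- exact: measurable_funB.
- by move=> x; have := phi01 x; lra.
- move=> e /H[g [tg g01 E]]; exists (fun x => 1 - g x); split.
  + exact: test_1B.
  + by move=> x; have := g01 x; lra.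
  + apply: le_trans E; rewrite le_eqVlt; apply/orP; left; apply/eqP.
    by apply: eq_integral => x _; rewrite opprB addrC addrA subrK distrC.
Qed.

Let meas_err (phi g : T -> R) : measurable_fun [set: T] phi -> measurable_fun [set: T] g ->
  measurable_fun [set: T] (fun x => (`|phi x - g x| * v x)%:E).
Proof.
move=> mphi mg; apply/measurable_EFinP; apply: measurable_funM => //.
by apply: measurableT_comp => //; exact: measurable_funB.
Qed.

Let test_meas g : test_fun g -> measurable_fun [set: T] g.
Proof. by case=> M [G []]. Qed.

(** phi psi - g h = (phi - g) psi + g (psi - h), with psi and g at most 1. *)
Lemma approximable_mul phi psi : approximable phi -> approximable psi ->
  approximable (fun x => phi x * psi x).
Proof.
move=> [mphi phi01 H] [mpsi psi01 H']; split.
- exact: measurable_funM.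
- by move=> x; have := phi01 x; have := psi01 x; nra.
- move=> e e0; have e20 : 0 < e / 2 by rewrite divr_gt0.
  have [g [tg g01 E]] := H _ e20; have [h [th h01 E']] := H' _ e20.
  exists (fun x => g x * h x); split.
  + exact: test_mul.
  + by move=> x; have := g01 x; have := h01 x; nra.
  + rewrite [in leRHS](splitr e) EFinD; apply: le_trans (leeD E E').
    rewrite -ge0_integralD//; first last.
    * by apply: meas_err => //; exact: test_meas.
    * by move=> x _; rewrite lee_fin mulr_ge0.
    * by apply: meas_err => //; exact: test_meas.
    * by move=> x _; rewrite lee_fin mulr_ge0.
    apply: ge0_le_integral => //.
    * by move=> x _; rewrite lee_fin mulr_ge0.
    * by apply: meas_err; apply: measurable_funM => //; exact: test_meas.
    * by apply: emeasurable_funD; apply: meas_err => //; exact: test_meas.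
    move=> x _; rewrite -EFinD lee_fin -mulrDl ler_wpM2r//.
    rewrite (_ : _ - _ = (phi x - g x) * psi x + g x * (psi x - h x)); last by ring.
    apply: le_trans (ler_normD _ _) _; rewrite !normrM lerD//.
      by rewrite ler_piMr// ger0_norm; case/andP: (psi01 x).
    by rewrite ler_piMl// ger0_norm; case/andP: (g01 x).
Qed.

(** Dominated convergence with the integrable majorant v. *)
Lemma approximable_lim (phi_ : nat -> T -> R) (phi : T -> R) :
  (forall N, approximable (phi_ N)) -> measurable_fun [set: T] phi ->
  (forall x, 0 <= phi x <= 1) ->
  {ae mu, forall x, phi_ N x @[N --> \oo] --> phi x} ->
  approximable phi.
Proof.
move=> H mphi phi01 cphi; split => // e e0.
have e20 : 0 < e / 2 by rewrite divr_gt0.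
pose f_ N x := (`|phi x - phi_ N x| * v x)%:E.
have mphi_ N : measurable_fun [set: T] (phi_ N) by case: (H N).
have [] := @dominated_convergence _ _ _ mu setT measurableT f_ (cst 0%E) (EFin \o v).
- by move=> N; exact: meas_err.
- exact: measurable_cst.
- apply: filterS cphi => x cx _; apply/cvg_EFin; first by apply: nearW.
  suff : (fun N => `|phi x - phi_ N x| * v x) @ \oo --> (0 : R) by [].
  rewrite -[X in _ --> X](mul0r (v x)); apply: cvgMr_tmp.
  rewrite -(normr0 R) -(subrr (phi x)); apply: cvg_norm.
  by apply: cvgB => //; exact: cvg_cst.
- exact: iv.
- apply: aeW => x N _; rewrite /f_ /= lee_fin normrM normr_id (ger0_norm (v0 x)).
  have [_ /(_ x) pN _] := H N; have p := phi01 x.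
  by rewrite ler_piMl// ler_norml; lra.
move=> _ _; rewrite integral0 => C.
have /C : nbhs 0%E [set y : \bar R | (y < (e / 2)%:E)%E].
  by apply: open_nbhs_nbhs; split; [exact: open_ereal_lt_ereal|rewrite /= lte_fin].
move=> [N _ /(_ N (leqnn N)) /= HN].
have [_ _ /(_ _ e20)[g [tg g01 E]]] := H N.
exists g; split => //.
rewrite [in leRHS](splitr e) EFinD; apply: le_trans (leeD (ltW HN) E).
rewrite -ge0_integralD//; first last.
- by apply: meas_err => //; exact: test_meas.
- by move=> x _; rewrite lee_fin mulr_ge0.
- exact: meas_err.
- by move=> x _; rewrite lee_fin mulr_ge0.
apply: ge0_le_integral => //.
- by move=> x _; rewrite lee_fin mulr_ge0.
- by apply: meas_err => //; exact: test_meas.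
- by apply: emeasurable_funD; apply: meas_err => //; exact: test_meas.
move=> x _; rewrite -EFinD lee_fin -mulrDl ler_wpM2r//.
exact: ler_distD.
Qed.

Lemma indic01 (A : set T) x : 0 <= (\1_A x : R) <= 1.
Proof. by rewrite indicE; case: (x \in A) => /=; rewrite ?lexx ?ler01. Qed.

(** The indicator of a countable union is the limit of
    1 - prod_(k < N) (1 - 1_(A_k)), a polynomial in the indicators. *)
Lemma approximable_sigma_algebra :
  sigma_algebra setT [set A | approximable (\1_A)].
Proof.
split => /=.
- rewrite indic0; apply: test_approximable; first exact: test_cst.
  by move=> x; rewrite lexx ler01.
- move=> A /approximable_1B; congr approximable; apply/funext => x.
  by rewrite setTD !indicE in_setC; case: (x \in A); rewrite /= ?subrr ?subr0.
move=> A HA.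
pose psi N x : R := \prod_(k < N) (1 - \1_(A k) x).
have apsi N : approximable (psi N).
  elim: N => [|N IH].
    rewrite (_ : psi 0%N = cst 1); last by apply/funext => x; rewrite /psi big_ord0.
    by apply: test_approximable; [exact: test_cst|move=> x; rewrite lexx ler01].
  rewrite (_ : psi N.+1 = (fun x => psi N x * (1 - \1_(A N) x))).
    by apply: approximable_mul => //; exact: approximable_1B.
  by apply/funext => x; rewrite /psi big_ord_recr.
apply: (approximable_lim (fun N => approximable_1B (apsi N))).
- have mA k : measurable (A k) by apply/(@measurable_indicP _ _ R); case: (HA k).
  by apply: measurable_indic; exact: bigcupT_measurable.
- exact: indic01.
apply: aeW => x; rewrite indicE; have [Ax|Ax] := pselect ((\bigcup_k A k) x).
  rewrite mem_set//.
  move: Ax => [k _ Akx]; apply: cvg_near_cst; exists k.+1 => // N /= kN.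
  by rewrite /psi (bigD1 (Ordinal kN))//= indicE mem_set// subrr mul0r subr0.
rewrite memNset//; apply: cvg_near_cst; apply: nearW => N; rewrite /psi big1 ?subrr// => k _.
by rewrite indicE memNset ?subr0// => Akx; apply: Ax; exists k.
Qed.

(** If b is positive exactly on 0 < x_i < q then 1 - (1 - b) ^ N increases to
    the indicator of that slab; it differs from x_i < q on the fundamental
    domain only by the negligible face x_i = 0.  Values of q outside ]0, L]
    give a constant indicator on the domain. *)
Lemma approximable_slab (i : 'I_n) (q : R) :
  approximable (\1_[set x : T | x 0 i < q]).
Proof.
have mA : measurable [set x : T | x 0 i < q].
  rewrite -[X in measurable X]setTI.
  have := @measurable_coor _ R n i measurableT `]-oo, q[%classic (measurable_itv _).
  by congr measurable; apply/seteqP; split => x /=; rewrite in_itv.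
have aecube (P : T -> Prop) : (forall x, cube L x -> P x) -> {ae mu, forall x, P x}.
  move=> H; exists (~` cube L); split.
  - by apply: measurableC; exact: measurable_cube.
  - by rewrite /= /torus_measure /mrestr setICl measure0.
  - by move=> x; apply: contra_not; exact: H.
have cst_case (c : R) : 0 <= c <= 1 ->
    (forall x, cube L x -> \1_[set x : T | x 0 i < q] x = c) ->
    approximable (\1_[set x : T | x 0 i < q]).
  move=> c01 Hc; apply: (approximable_lim (phi_ := fun=> cst c)).
  - by move=> _; apply: test_approximable; [exact: test_cst|].
  - exact: measurable_indic.
  - exact: indic01.
  - by apply: aecube => x /Hc ->; exact: cvg_cst.
have [q0|q0] := leP q 0.
  apply: (cst_case 0); first by rewrite lexx ler01.
  move=> x /(_ i)/andP[x0 _]; rewrite indicE memNset//=.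
  by apply/negP; rewrite -leNgt (le_trans q0).
have [qL|qL] := ltP L q.
  apply: (cst_case 1); first by rewrite lexx ler01.
  move=> x /(_ i)/andP[_ xL]; rewrite indicE mem_set//=.
  exact: le_lt_trans qL.
have [b [tb b01 bP]] := test_slab i (introT andP (conj q0 qL)).
apply: (approximable_lim (phi_ := fun N x => 1 - (1 - b x) ^+ N)).
- move=> N; apply: test_approximable; first by apply/test_1B/test_exp/test_1B.
  move=> x; have /andP[b0 b1] := b01 x.
  by rewrite subr_ge0 exprn_ile1 ?gerBl ?exprn_ge0//= ?subr_ge0//; lra.
- exact: measurable_indic.
- exact: indic01.
have ae1 : {ae mu, forall x, cube L x} by exact: aecube.
have ae2 : {ae mu, forall x : T, x 0 i <> 0}.
  exists [set x : T | x 0 i = 0]; split.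
  - exact: measurable_hyperplane.
  - exact: torus_hyperplane.
  - by move=> x /= /contrapT.
move: ae1 ae2; apply: filterS2.
move=> x cx x0; have := bP x cx; have /andP[_ b1] := b01 x.
have xpos : 0 < x 0 i by rewrite lt_neqAle eq_sym; move: (cx i) => /andP[-> _]; rewrite andbT; apply/eqP.
rewrite xpos/= indicE => E.
have [bp|bp] := ltP 0 (b x).
  rewrite mem_set/=; last by rewrite -E.
  rewrite -[X in _ --> X]subr0; apply: cvgB; first exact: cvg_cst.
  apply: cvg_expr; rewrite ger0_norm; lra.
rewrite memNset/=; last by apply/negP; rewrite -E -leNgt.
have -> : b x = 0 by apply/eqP; rewrite eq_le bp; case/andP: (b01 x).
by apply: cvg_near_cst; apply: nearW => N; rewrite subr0 expr1n subrr.
Qed.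

(** The half-spaces x_i < q generate the sigma-algebra on row vectors. *)
Lemma approximable_measurable (A : set T) : measurable A -> approximable (\1_A).
Proof.
suff : (@measurable _ T) `<=` [set A | approximable (\1_A)] by apply.
apply: smallest_sub; first exact: approximable_sigma_algebra.
rewrite -bigcup_seq => _ [i _ [B mB <-]] /=; rewrite setTI.
suff : (@measurable _ R) `<=` [set B | approximable (\1_((fun x : T => x ord0 i) @^-1` B))].
  exact.
rewrite [X in X `<=` _](RGenInftyO.measurableE R); apply: smallest_sub.
  have [H0 HC HU] := approximable_sigma_algebra.
  split => /=.
  - by rewrite preimage_set0; exact: H0.
  - by move=> C /HC; rewrite !setTD preimage_setC.
  - by move=> F HF; rewrite preimage_bigcup; exact: HU.
move=> _ [q ->] /=; have := approximable_slab i q.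
by congr (approximable \1_ _); apply/seteqP; split => x /=; rewrite in_itv.
Qed.

End density.

(** * Total variation controls translations *)

Section vector_field.
Context {R : realType} {n : nat} (L : R).
Local Notation T := ('rV[R]_n).
Variables (M : R) (g : T -> R) (G : T -> T) (w : T).
Hypothesis Cg : c11 L M g G.

Lemma mul_outer (a b s : T) : s *m (a^T *m b) = dotv a s *: b.
Proof.
apply/rowP => j; rewrite mulmxA !mxE big_ord1 !mxE; congr (_ * _).
by apply: eq_bigr => i _; rewrite !mxE mulrC.
Qed.

(** The quadratic remainder is a little o of the increment, so it identifies
    the differential of the vector field g w. *)
Lemma c11_field_diff x : differentiable (fun x => g x *: w) x /\
  forall s, 'd (fun x => g x *: w) x s = dotv (G x) s *: w.
Proof.
have [_ _ _ _ M0 b bG lG r] := Cg.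
pose df : {linear T -> T} := mulmxr ((G x)^T *m w).
have dfE s : df s = dotv (G x) s *: w by rewrite /df/= mul_outer.
have cdf : continuous df.
  apply/linear_bounded_continuous/linear_boundedP.
  exists (M * `|w|); split; first exact: num_real.
  move=> k /ltW Mk s; rewrite dfE normrZ.
  apply: (@le_trans _ _ (M * `|s| * `|w|)); first by rewrite ler_wpM2r.
  by rewrite mulrAC ler_wpM2r.
have E : (fun x => g x *: w) \o shift x = cst (g x *: w) + df +o_ 0 id.
  apply/eqaddoP => e e0.
  have K0 : 0 < M * `|w| + 1 by rewrite ltr_wpDl// mulr_ge0.
  have NB : \forall s \near (0 : T), `|s| <= e / (M * `|w| + 1).
    by apply: nbhs0_le; rewrite divr_gt0.
  near=> s; have se : `|s| <= e / (M * `|w| + 1) by near: s; exact: NB.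
  rewrite [X in `|X|](_ : _ = (g (x + s) - g x - dotv (G x) s) *: w); last first.
    rewrite !scalerBl -dfE; change (g (s + x) *: w - (g x *: w + df s) =
      g (x + s) *: w - g x *: w - df s).
    by rewrite opprD addrA [s + x]addrC.
  rewrite normrZ; apply: (@le_trans _ _ (M * `|s| ^+ 2 * `|w|)).
    by rewrite ler_wpM2r.
  move: se; rewrite ler_pdivlMr// => se; rewrite expr2 mulrA mulrAC ler_wpM2r//.
  have : M * `|s| * `|w| = `|s| * (M * `|w|) by ring.
  have := normr_ge0 s; lra.
have DE := diff_unique cdf E.
split; last by move=> s; rewrite DE.
by apply/diff_locallyP; rewrite DE.
Unshelve. all: by end_near. Qed.

Lemma c11_field_jacobian x : jacobian (fun x => g x *: w) x = (G x)^T *m w.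
Proof.
apply/matrixP => i j; rewrite mxE (c11_field_diff x).2 dotv_delta !mxE big_ord1.
by rewrite !mxE.
Qed.

Lemma c11_field_C1 : C1 (fun x => g x *: w).
Proof.
split=> [x|]; first by have [] := c11_field_diff x.
have [_ _ _ _ M0 _ _ lG _] := Cg.
move=> x; apply/(@cvgrPdist_le _ _ _ (nbhs (x : T)) (nbhs_filter (x : T))) => e e0.
have K0 : 0 < M * `|w| + 1 by rewrite ltr_wpDl// mulr_ge0.
near=> y; rewrite !c11_field_jacobian [leLHS]mx_normrE.
apply: bigmax_le => [|[i j] _ /=]; first exact: ltW.
rewrite !mxE !big_ord1 !mxE -mulrBl -!(dotv_delta _ i).
apply: le_trans (normrM_le (lG y x (delta_mx 0 i)) (ler_coord_norm w j)) _.
have d1 : `|delta_mx 0 i : T| <= 1.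
  by apply: ler_norm_coord => // k; rewrite mxE; case: (_ && _); rewrite ?normr1 ?normr0.
have yx : `|x - y| <= e / (M * `|w| + 1).
  by near: y; apply: cvgr_dist_le => //; rewrite divr_gt0.
move: yx; rewrite ler_pdivlMr// => yx; apply: le_trans yx.
apply: (@le_trans _ _ (M * `|x - y| * 1 * `|w|)).
  by rewrite ler_wpM2r// ler_wpM2l// mulr_ge0.
have : M * `|x - y| * 1 * `|w| = `|x - y| * (M * `|w|) by ring.
have := normr_ge0 (x - y); lra.
Unshelve. all: by end_near. Qed.

Lemma c11_field_divergence x : divergence (fun x => g x *: w) x = dotv (G x) w.
Proof.
rewrite /divergence c11_field_jacobian /mxtrace /dotv; apply: eq_bigr => i _.
by rewrite !mxE big_ord1 !mxE.
Qed.

Lemma euclidean_normZ (k : R) (x : T) : euclidean_norm (k *: x) = `|k| * euclidean_norm x.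
Proof.
rewrite /euclidean_norm -sqrtr_sqr -sqrtrM ?sqr_ge0// mulr_sumr.
by congr Num.sqrt; apply: eq_bigr => i _; rewrite mxE exprMn.
Qed.

(** The fields g w with a fixed direction w suffice to detect translations;
    their divergence is the derivative of g along w. *)
Lemma variation_ge (u : T -> R) : (forall x, `|g x| <= 1) -> euclidean_norm w <= 1 ->
  (\int[torus_measure L]_x (u x * dotv (G x) w)%:E <= torus_variation L u)%E.
Proof.
move=> g1 w1; apply: ereal_sup_ubound; exists (fun x => g x *: w).
  split; first exact: c11_field_C1.
  - by move=> i x; rewrite (c11_per Cg).
  - by move=> x; rewrite euclidean_normZ mulr_ile1// sqrtr_ge0.
by apply: eq_integral => x _; rewrite c11_field_divergence.
Qed.

End vector_field.

(** The zero field is admissible. *)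
Lemma torus_variation_ge0 (R : realType) (n : nat) (L : R) (u : 'rV[R]_n -> R) :
  (0 <= torus_variation L u)%E.
Proof.
have := variation_ge (w := 0) (c11_cst L 0) u.
rewrite integral0_eq; first apply.
- by move=> x; rewrite normr0.
- by rewrite /euclidean_norm big1 ?sqrtr0// => i _; rewrite mxE expr0n.
- by move=> x _; rewrite dotv0l mulr0.
Qed.

Section variation_shift.
Context {R : realType} {n : nat} (L : R).
Local Notation T := ('rV[R]_n).
Local Notation mu := (@torus_measure R n L).
Variable u : T -> R.
Hypothesis L0 : 0 < L.
Hypothesis mu_ : measurable_fun [set: T] u.
Hypothesis pu : lattice_periodic L u.
Hypothesis u0 : forall x, 0 <= u x.
Hypothesis iu : mu.-integrable setT (EFin \o u).
Hypothesis V_fin : (torus_variation L u < +oo)%E.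

Let V := fine (torus_variation L u).
Let I f := (\int[mu]_x (u x * f x))%R.

Lemma integrable_mul_bounded (w f : T -> R) (K : R) :
  mu.-integrable setT (EFin \o w) -> measurable_fun [set: T] f ->
  (forall x, `|f x| <= K) -> mu.-integrable setT (EFin \o (fun x => w x * f x)).
Proof.
move=> iw mf fK.
have mw : measurable_fun [set: T] w by apply/measurable_EFinP; exact: measurable_int iw.
apply: (@le_integrable _ _ _ _ _ measurableT _ (fun x => (K%:E * (EFin \o w) x)%E)).
- by apply/measurable_EFinP; exact: measurable_funM.
- move=> x _ /=; rewrite lee_fin !normrM mulrC ler_wpM2r//.
  by rewrite (le_trans (fK x))// ler_norm.
- exact: integrableZl.
Qed.

Let iD (f g : T -> R) : mu.-integrable setT (EFin \o f) ->
  mu.-integrable setT (EFin \o g) ->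
  mu.-integrable setT (EFin \o (fun x => f x + g x)).
Proof. by move=> intf intg; exact: (integrableD measurableT intf intg). Qed.

Let iB (f g : T -> R) : mu.-integrable setT (EFin \o f) ->
  mu.-integrable setT (EFin \o g) ->
  mu.-integrable setT (EFin \o (fun x => f x - g x)).
Proof. by move=> intf intg; exact: (integrableB measurableT intf intg). Qed.

Let iZ (k : R) (f : T -> R) : mu.-integrable setT (EFin \o f) ->
  mu.-integrable setT (EFin \o (fun x => k * f x)).
Proof. by move=> intf; exact: (integrableZl measurableT k intf). Qed.

Let V_E : torus_variation L u = V%:E /\ 0 <= V.
Proof.
have V0 := torus_variation_ge0 L u.
by rewrite /V fineK ?ge0_fin_numE// fine_ge0.
Qed.

Lemma c11_shift M g G (a : T) : c11 L M g G ->
  c11 L M (fun x => g (x + a)) (fun x => G (x + a)).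
Proof.
have ma := measurable_shift a.
move=> [mg mG pg pG M0 b bG lG r]; split => //.
- exact: measurableT_comp mg ma.
- by move=> i; exact: measurableT_comp (mG i) ma.
- by move=> i x; rewrite addrAC pg.
- by move=> i x; rewrite addrAC pG.
- by move=> x y s; apply: le_trans (lG _ _ _) _; rewrite opprD addrACA subrr addr0.
- by move=> x s; rewrite (addrAC x).
Qed.

Lemma euclidean_norm_eq0 (w : T) : euclidean_norm w = 0 -> w = 0.
Proof.
move=> /eqP; rewrite sqrtr_eq0 => w0; apply/rowP => i; rewrite mxE.
have : w 0 i ^+ 2 <= 0.
  by apply: le_trans w0; rewrite (bigD1 i)//= lerDl sumr_ge0// => j _; rewrite sqr_ge0.
by move=> wi; apply/eqP; rewrite -sqrf_eq0 eq_le wi sqr_ge0.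
Qed.

Lemma measurable_dotv (G : T -> T) (w : T) :
  (forall i, measurable_fun [set: T] (fun x => G x 0 i)) ->
  measurable_fun [set: T] (fun x => dotv (G x) w).
Proof.
by move=> mG; apply: measurable_sum => i; exact: measurable_funM.
Qed.

Let grad_le M g G w : c11 L M g G -> (forall x, `|g x| <= 1) ->
  I (fun x => dotv (G x) w) <= euclidean_norm w * V.
Proof.
move=> Cg g1; set e := euclidean_norm w.
have e0 : 0 <= e by exact: sqrtr_ge0.
have [ee|ee] := eqVneq e 0.
  rewrite /I (eq_Rintegral _ (g := fun=> 0)) ?Rintegral_cst ?mul0r ?ee ?mul0r//.
  move=> x _; rewrite (euclidean_norm_eq0 ee).
  by rewrite /dotv big1 ?mulr0// => i _; rewrite mxE mulr0.
have ep : 0 < e by rewrite lt_neqAle eq_sym ee.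
have H := variation_ge (w := e^-1 *: w) Cg u g1.
have dE x : dotv (G x) w = e * dotv (G x) (e^-1 *: w).
  rewrite /dotv mulr_sumr; apply: eq_bigr => i _; rewrite mxE; field.
  exact: ee.
have id : mu.-integrable setT (EFin \o (fun x => u x * dotv (G x) (e^-1 *: w))).
  apply: (@integrable_mul_bounded _ _ (M * `|e^-1 *: w|)) => //.
    by apply: measurable_dotv; exact: c11_mgrad Cg.
  by move=> x; exact: c11_bgrad Cg _ _.
rewrite /I (eq_Rintegral _ (g := fun x : T => e * (u x * dotv (G x) (e^-1 *: w)))); last first.
  by move=> x _; rewrite dE; ring.
rewrite RintegralZl// ler_wpM2l// -lee_fin.
have [<- _] := V_E; rewrite [X in (X <= _)%E]fineK; last exact: integrable_fin_num.
apply: H; rewrite euclidean_normZ ger0_norm ?invr_ge0//.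
by rewrite mulVf.
Qed.

Let integrable_shift_diff M g G a b : c11 L M g G ->
  mu.-integrable setT (EFin \o (fun x => u x * (g (x + a) - g (x + b)))).
Proof.
move=> Cg; apply: (@integrable_mul_bounded _ _ (2 * M)) => //.
  by apply: measurable_funB; exact: measurableT_comp (c11_mfun Cg) (measurable_shift _).
move=> x; apply: le_trans (ler_normB _ _) _.
have := c11_bnd Cg (x + a); have := c11_bnd Cg (x + b); lra.
Qed.

(** One step along s: the linear term is bounded by the variation, since the
    translate of g is again a test function; the error is quadratic. *)
Let step_le M g G a s : c11 L M g G -> (forall x, `|g x| <= 1) ->
  I (fun x => g (x + (a + s)) - g (x + a)) <=
  euclidean_norm s * V + M * `|s| ^+ 2 * I (cst 1).
Proof.
move=> Cg g1; have Ca := c11_shift a Cg.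
have id : mu.-integrable setT (EFin \o (fun x => u x * dotv (G (x + a)) s)).
  apply: (@integrable_mul_bounded _ _ (M * `|s|)) => //.
    by apply: measurable_dotv; exact: c11_mgrad Ca.
  by move=> x; exact: c11_bgrad Ca _ _.
have ic : mu.-integrable setT (EFin \o (fun x => M * `|s| ^+ 2 * (u x * 1))).
  by apply: iZ; move: iu; congr (_.-integrable _ _); apply/funext => x /=; rewrite mulr1.
have i1 : mu.-integrable setT (EFin \o (fun x => u x * cst 1 x)).
  by move: iu; congr (_.-integrable _ _); apply/funext => x /=; rewrite mulr1.
apply: (@le_trans _ _ (\int[mu]_x (u x * dotv (G (x + a)) s + M * `|s| ^+ 2 * (u x * 1)))%R).
  apply: le_Rintegral => //.
  - exact: integrable_shift_diff Cg.
  - exact: iD.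
  - move=> x _; rewrite (addrA x); have := c11_rem Cg (x + a) s.
    rewrite ler_norml => /andP[_]; have := u0 x.
    set A := g _; set B := g _; set D := dotv _ _; set E := M * _ => ux H.
    have -> : u x * D + E * (u x * 1) = u x * (D + E) by ring.
    rewrite ler_wpM2l//; lra.
rewrite RintegralD// lerD//; first exact: grad_le Ca _.
by rewrite RintegralZl.
Qed.

Let steps_le M g G s k : c11 L M g G -> (forall x, `|g x| <= 1) ->
  I (fun x => g (x + s *+ k) - g x) <=
  (euclidean_norm s * V + M * `|s| ^+ 2 * I (cst 1)) *+ k.
Proof.
move=> Cg g1; elim: k => [|k IH].
  rewrite !mulr0n /I (eq_Rintegral _ (g := fun=> 0)) ?Rintegral_cst ?mul0r//.
  by move=> x _; rewrite addr0 subrr mulr0.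
have E : I (fun x => g (x + s *+ k.+1) - g x) =
    I (fun x => g (x + (s *+ k + s)) - g (x + s *+ k)) + I (fun x => g (x + s *+ k) - g x).
  rewrite /I -RintegralD//.
  - by apply: eq_Rintegral => x _; rewrite -mulrSr; ring.
  - exact: integrable_shift_diff Cg.
  - have := integrable_shift_diff (s *+ k) 0 Cg.
    by congr (_.-integrable _ _); apply/funext => x /=; rewrite addr0.
by rewrite E mulrSr addrC lerD//; exact: step_le Cg _.
Qed.

(** Cutting h into N steps leaves an error of order 1 / N. *)
Let increment_le g h : test_fun L g -> (forall x, `|g x| <= 1) ->
  I (fun x => g (x + h) - g x) <= euclidean_norm h * V.
Proof.
move=> [M [G Cg]] g1; have M0 := c11_ge0 Cg.
have I1 : 0 <= I (cst 1) by apply: Rintegral_ge0 => x _; rewrite mulr1.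
set c := M * `|h| ^+ 2 * I (cst 1).
have c0 : 0 <= c by rewrite !mulr_ge0// sqr_ge0.
apply/ler_addgt0Pr => e e0; set N := (Num.truncn (c / e)).+1.
have N0 : (0 : R) < N%:R by rewrite ltr0n.
have cN : c / N%:R <= e.
  rewrite ler_pdivrMr// mulrC -ler_pdivrMr// ltW//.
  by have := truncnS_gt (c / e); rewrite /N.
have := steps_le (N%:R^-1 *: h) N Cg g1.
rewrite -scaler_nat scalerA mulfV ?gt_eqF// scale1r => /le_trans; apply.
rewrite euclidean_normZ normrZ ger0_norm ?invr_ge0 ?(ltW N0)//.
apply: le_trans (_ : euclidean_norm h * V + c / N%:R <= _); last by rewrite lerD2l.
rewrite -mulr_natr le_eqVlt; apply/orP; left; apply/eqP; rewrite /c; field.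
by rewrite gt_eqF.
Qed.

Let integrable_shift h : mu.-integrable setT (EFin \o (fun x => u (x + h))).
Proof.
have mh : measurable_fun [set: T] (fun x => u (x + h)).
  exact: measurableT_comp mu_ (measurable_shift h).
apply/integrableP; split; first by apply/measurable_EFinP.
have /integrableP[_] := iu; congr (_ < _)%E; apply/esym.
rewrite -(ge0_torus_integral_shift h L0 (f := fun x => `|(EFin \o u) x|%E))//.
- by apply: measurableT_comp => //; apply/measurable_EFinP.
- by move=> i x /=; rewrite pu.
Qed.

Let shift_test g h : test_fun L g -> (forall x, 0 <= g x <= 1) ->
  (\int[mu]_x (u (x + h) * g x))%R = I (fun x => g (x - h)).
Proof.
move=> [M [G Cg]] g01; rewrite /I /Rintegral; congr fine.
rewrite -(ge0_torus_integral_shift h L0 (f := fun x => (u x * g (x - h))%:E)).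
- by apply: eq_integral => x _; rewrite addrK.
- apply/measurable_EFinP; apply: measurable_funM => //.
  exact: measurableT_comp (c11_mfun Cg) (measurable_shift _).
- by move=> x; rewrite lee_fin mulr_ge0//; case/andP: (g01 (x - h)).
- by move=> i x; rewrite pu addrAC (c11_per Cg).
Qed.

(** The previous bound for the function 2 g - 1, with values in [-1, 1]; the
    constant drops out because a difference of translates is taken, which
    yields the factor 2. *)
Let diff_test_le g h : test_fun L g -> (forall x, 0 <= g x <= 1) ->
  2 * (\int[mu]_x ((u (x + h) - u x) * g x))%R <= euclidean_norm h * V.
Proof.
move=> tg g01; have [M [G Cg]] := tg.
have g1 x : `|g x| <= 1 by rewrite ger0_norm; case/andP: (g01 x).
have ig : mu.-integrable setT (EFin \o (fun x => u x * g x)).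
  by apply: (@integrable_mul_bounded _ _ 1) => //; exact: c11_mfun Cg.
have igh : mu.-integrable setT (EFin \o (fun x => u x * g (x - h))).
  apply: (@integrable_mul_bounded _ _ 1) => //.
  exact: measurableT_comp (c11_mfun Cg) (measurable_shift _).
have iugh : mu.-integrable setT (EFin \o (fun x => u (x + h) * g x)).
  by apply: (@integrable_mul_bounded _ _ 1) => //; exact: c11_mfun Cg.
have eN : euclidean_norm (- h) = euclidean_norm h.
  by rewrite -scaleN1r euclidean_normZ normrN normr1 mul1r.
have : test_fun L (fun x => cst 2 x * g x + cst (-1) x).
  by apply: test_add; [apply: test_mul => //; exact: test_cst|exact: test_cst].
move=> /(increment_le (- h)); rewrite eN => H.
apply: le_trans (H _); last first.
  by move=> x; rewrite ler_norml /=; have := g01 x; lra.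
rewrite (eq_Rintegral _ (g := fun x : T => u (x + h) * g x - u x * g x)); last first.
  by move=> x _; ring.
rewrite RintegralB// shift_test// /I -RintegralB// -RintegralZl//; last first.
  exact: iB.
by rewrite le_eqVlt; apply/orP; left; apply/eqP; apply: eq_Rintegral => x _ /=; ring.
Qed.

(** With w x = u (x + h) - u x of zero mean, int |w| is twice the integral of
    w over the set where w >= 0.  The indicator of that set is approximated by
    a test function in L^1 (|w|), and the test function is handled by duality
    with the variation. *)
Lemma variation_shift h :
  (\int[mu]_x `|u (x + h) - u x|%:E <= (euclidean_norm h)%:E * torus_variation L u)%E.
Proof.
pose w x := u (x + h) - u x.
have iw : mu.-integrable setT (EFin \o w).
  exact: iB.
have mw : measurable_fun [set: T] w by apply/measurable_EFinP; exact: measurable_int iw.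
have ianw : mu.-integrable setT (EFin \o (fun x => `|w x|)) by exact: integrable_norm.
pose A := [set x : T | 0 <= w x].
have mA : measurable A.
  rewrite -[X in measurable X]setTI.
  have := mw measurableT `[0, +oo[%classic (measurable_itv _).
  by congr measurable; apply/seteqP; split => x [_] /=; rewrite in_itv/= andbT.
have mA1 : measurable_fun [set: T] (\1_A : T -> R) by exact: measurable_indic.
have [-> _] := V_E.
rewrite -[X in (X <= _)%E]fineK; last exact: integrable_fin_num.
rewrite -EFinM lee_fin.
(* The mean of u is invariant under translation. *)
have w0 : (\int[mu]_x w x)%R = 0.
  rewrite RintegralB//; apply/eqP; rewrite subr_eq0; apply/eqP.
  have t1 : test_fun L (cst 1 : T -> R) by exact: test_cst.
  have := shift_test h t1; rewrite /I => E.
  rewrite (eq_Rintegral _ (g := fun x : T => u (x + h) * cst 1 x)); last by move=> x _; rewrite mulr1.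
  rewrite E; last by move=> x; rewrite lexx ler01.
  by apply: eq_Rintegral => x _; rewrite mulr1.
have iwA : mu.-integrable setT (EFin \o (fun x => w x * \1_A x)).
  apply: (@integrable_mul_bounded _ _ 1) => // x.
  by have /andP[a b] := indic01 A x; rewrite ger0_norm.
(* |w| = 2 w 1_A - w pointwise, and w integrates to 0. *)
have wA : (\int[mu]_x `|w x|)%R = 2 * (\int[mu]_x (w x * \1_A x))%R.
  rewrite -[RHS]subr0 -[X in _ - X]w0 -RintegralZl// -RintegralB//; last first.
    exact: iZ.
  apply: eq_Rintegral => x _; rewrite indicE.
  have [wx|wx] := leP 0 (w x); first by rewrite mem_set// ger0_norm//=; ring.
  by rewrite memNset ?ltr0_norm//=; [ring|apply/negP; rewrite -ltNge].
have [_ _ H] := approximable_measurable (fun x => normr_ge0 (w x)) ianw mA.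
change ((\int[mu]_x `|w x|)%R <= euclidean_norm h * V).
apply/ler_addgt0Pr => e e0; have e20 : 0 < e / 2 by rewrite divr_gt0.
have [g [tg g01 E]] := H _ e20.
have mg : measurable_fun [set: T] g by case: tg => M [G /c11_mfun].
have g1 x : `|g x| <= 1 by rewrite ger0_norm; case/andP: (g01 x).
have iwg : mu.-integrable setT (EFin \o (fun x => w x * g x)).
  exact: (@integrable_mul_bounded _ _ 1).
have ierr : mu.-integrable setT (EFin \o (fun x => `|\1_A x - g x| * `|w x|)).
  rewrite (_ : (fun x => _) = (fun x => `|w x| * `|\1_A x - g x|)); last first.
    by apply/funext => x; rewrite mulrC.
  apply: (@integrable_mul_bounded _ _ 1) => //.
    by apply: measurableT_comp => //; exact: measurable_funB.
  move=> x; rewrite normr_id ler_norml.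
  by have := g01 x; have := indic01 A x; lra.
have E' : (\int[mu]_x (`|\1_A x - g x| * `|w x|))%R <= e / 2.
  by rewrite -lee_fin fineK//; exact: integrable_fin_num.
have : (\int[mu]_x (w x * \1_A x))%R <=
    (\int[mu]_x (w x * g x))%R + (\int[mu]_x (`|\1_A x - g x| * `|w x|))%R.
  rewrite -RintegralD//; apply: le_Rintegral => //.
    exact: iD.
  move=> x _; rewrite -normrM.
  have := ler_norm ((\1_A x - g x) * w x); set a := \1_A x; set z := `|_|.
  have -> : w x * a = w x * g x + (a - g x) * w x by ring.
  lra.
have := diff_test_le h tg g01; rewrite -/(w _) wA.
set a := Rintegral _ _ (fun x => w x * g x).
set b := Rintegral _ _ (fun x => w x * \1_A x).
move=> H1 H2; have H3 : b <= a + e / 2 by apply: le_trans H2 _; rewrite lerD2l.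
have : 2 * a <= euclidean_norm h * V by exact: H1.
lra.
Qed.

End variation_shift.

(** * Transport plans and thickened sets *)

Section torus_dist.
Context {R : realType} {n : nat} (L : R).
Local Notation T := ('rV[R]_n).

(** Periodicity along the coordinate vectors extends to the whole lattice, one
    coordinate at a time. *)
Lemma lattice_periodic_int (X : Type) (f : T -> X) (k : 'rV[int]_n) x :
  lattice_periodic L f -> f (x + L *: map_mx intr k) = f x.
Proof.
move=> pf; have -> : L *: map_mx intr k = \sum_i (L * (k 0 i)%:~R) *: (delta_mx 0 i : T).
  rewrite {1}(row_sum_delta (map_mx intr k)) scaler_sumr; apply: eq_bigr => i _.
  by rewrite mxE scalerA.
elim: (index_enum _) x => [|i s IH] x; first by rewrite big_nil addr0.
rewrite big_cons addrA IH.
have := @periodic_int R X L (fun t => f (x + t *: delta_mx 0 i)) (k 0 i) 0.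
rewrite add0r scale0r addr0; apply => t.
by rewrite scalerDl addrA pf.
Qed.

Lemma torus_dist_has_inf (x y : T) : has_inf
  [set euclidean_norm (x - y + L *: map_mx intr k) | k in [set: 'rV[int]_n]].
Proof.
split; first by exists (euclidean_norm (x - y + L *: map_mx intr 0)), 0.
by exists 0 => _ [k _ <-]; exact: sqrtr_ge0.
Qed.

Lemma torus_dist_ge0 (x y : T) : 0 <= torus_dist L x y.
Proof.
apply: lb_le_inf; first by have [] := torus_dist_has_inf x y.
by move=> _ [k _ <-]; exact: sqrtr_ge0.
Qed.

(** Strict inequalities are unaffected by whether the infimum is attained. *)
Lemma torus_dist_lt (x y : T) (a : R) : torus_dist L x y < a <->
  exists k : 'rV[int]_n, euclidean_norm (x - y + L *: map_mx intr k) < a.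
Proof.
have [N0 lb] := torus_dist_has_inf x y; split.
  by move=> /(inf_lt N0)[_ [k _ <-]] ?; exists k.
move=> [k]; apply: le_lt_trans; exact: ge_inf.
Qed.

Lemma measurable_euclidean_norm : measurable_fun [set: T] (@euclidean_norm R n).
Proof.
apply: (measurableT_comp (f := @Num.sqrt R)).
  by apply: continuous_measurable_fun; exact: sqrt_continuous.
by apply: measurable_sum => i; apply: measurable_funX; exact: measurable_coor.
Qed.

(** Its strict sublevel sets are countable unions over the lattice. *)
Lemma measurable_torus_dist :
  measurable_fun [set: T * T] (fun z : T * T => torus_dist L z.1 z.2).
Proof.
apply: (measurability _ (RGenInftyO.measurableE R)) => //.
move=> /= _ [_ [a ->] <-]; rewrite setTI.
rewrite (_ : _ @^-1` _ = \bigcup_(k : 'rV[int]_n)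
    [set z : T * T | euclidean_norm (z.1 - z.2 + L *: map_mx intr k) < a]).
  apply: countable_bigcupT_measurable => // k.
  have m : measurable_fun [set: T * T]
      (fun z : T * T => euclidean_norm (z.1 - z.2 + L *: map_mx intr k)).
    apply: measurableT_comp; first exact: measurable_euclidean_norm.
    apply: measurable_fun_rVP => i.
    rewrite (_ : (fun x => _) = (fun z : T * T =>
       z.1 0 i - z.2 0 i + (L *: map_mx intr k) 0 i)); last first.
      by apply/funext => z; rewrite mxE [in LHS]mxE [X in _ + X + _]mxE.
    apply: measurable_funD => //; apply: measurable_funB.
      exact: measurableT_comp (measurable_coor i) measurable_fst.
    exact: measurableT_comp (measurable_coor i) measurable_snd.
  have := m measurableT `]-oo, a[%classic (measurable_itv _).
  by congr measurable; apply/seteqP; split => z /=; rewrite in_itv/= => // -[].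
apply/seteqP; split => z /=; rewrite in_itv/=.
  by move=> /torus_dist_lt[k]; exists k.
by move=> [k _ ?]; apply/torus_dist_lt; exists k.
Qed.

End torus_dist.

(** Setting of the transport estimate: G is a periodic set, Gs w its translate
    by r w.  For w uniform in the unit cube, gam (x in Gs w) is the mass of u
    seen from G at offset r w, and gam (y in Gs w) is always the volume
    of G. *)
Section transport.
Context {R : realType} {n : nat} (L : R).
Local Notation T := ('rV[R]_n).
Local Notation mu := (@torus_measure R n L).
Local Notation leb := (@lebesgue_rV R n).
Variables (u : T -> R) (gam : {finite_measure set (T * T)%type -> \bar R}).
Hypothesis L0 : 0 < L.
Hypothesis mu_ : measurable_fun [set: T] u.
Hypothesis pu : lattice_periodic L u.
Hypothesis u0 : forall x, 0 <= u x.
Hypothesis cgam : coupling L u (cst 1) gam.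
Variables (G : set T) (r rho : R).
Hypothesis mG : measurable G.
Hypothesis pG : lattice_periodic L G.
Hypothesis r0 : 0 < r.
Hypothesis rho0 : 0 <= rho.

Let Gs (w : T) : set T := [set x | G (x - r *: w)].
Let near : set (T * T) := [set z | torus_dist L z.1 z.2 < rho].
Let far : set (T * T) := [set z | rho <= torus_dist L z.1 z.2].
Let a := rho / r.
Let unit_cube : set T := cube 1.
Let big_cube : set T := [set w | cube (1 + 2 * a) (w + const_mx a)].

Let a0 : 0 <= a. Proof. by rewrite /a divr_ge0// ltW. Qed.

Let measurable_shift_scale (p : T * T -> T) : measurable_fun [set: T * T] p ->
  measurable_fun [set: (T * T) * T] (fun zw : (T * T) * T => p zw.1 - r *: zw.2).
Proof.
move=> mp; apply: measurable_fun_rVP => i.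
rewrite (_ : (fun x => _) = (fun zw : (T * T) * T => p zw.1 0 i - r * zw.2 0 i)); last first.
  by apply/funext => z; rewrite !mxE.
apply: measurable_funB.
  apply: measurableT_comp (measurable_coor i) _.
  exact: measurableT_comp mp measurable_fst.
apply: measurable_funM => //.
exact: measurableT_comp (measurable_coor i) measurable_snd.
Qed.

Let measurable_Gs w : measurable (Gs w).
Proof.
have := measurable_shift (- (r *: w)) measurableT mG.
by rewrite setTI.
Qed.

Let measurable_kernel (p : T * T -> T) (B : set T) (D : set (T * T)) :
  measurable_fun [set: T * T] p -> measurable B -> measurable D ->
  measurable_fun [set: (T * T) * T] (fun zw : (T * T) * T =>
    (\1_B zw.2 * (\1_D zw.1 * \1_(Gs zw.2) (p zw.1)) : R)%:E).
Proof.
move=> mp mB mD.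
have mGp : measurable [set zw : (T * T) * T | G (p zw.1 - r *: zw.2)].
  by have := measurable_shift_scale mp measurableT mG; rewrite setTI.
apply/measurable_EFinP; apply: measurable_funM.
  have mB1 : measurable_fun [set: T] (\1_B : T -> R) by exact: measurable_indic.
  exact: measurableT_comp mB1 measurable_snd.
apply: measurable_funM.
  have mD1 : measurable_fun [set: T * T] (\1_D : T * T -> R) by exact: measurable_indic.
  exact: measurableT_comp mD1 measurable_fst.
rewrite (_ : (fun x => _) = \1_[set zw : (T * T) * T | G (p zw.1 - r *: zw.2)]).
  exact: measurable_indic.
by apply/funext => zw; rewrite !indicE.
Qed.

Let kernel_ge0 (p : T * T -> T) (B : set T) (D : set (T * T)) (zw : (T * T) * T) :
  (0 <= (\1_B zw.2 * (\1_D zw.1 * \1_(Gs zw.2) (p zw.1)) : R)%:E)%E.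
Proof. by rewrite lee_fin !mulr_ge0. Qed.

Let fubini_Gs (p : T * T -> T) (B : set T) (D : set (T * T)) :
  measurable_fun [set: T * T] p -> measurable B -> measurable D ->
  (\int[leb]_w ((\1_B w)%:E * gam (D `&` p @^-1` Gs w)) =
   \int[gam]_z \int[leb]_w (\1_B w * (\1_D z * \1_(Gs w) (p z)))%:E)%E.
Proof.
move=> mp mB mD; have mf := measurable_kernel mp mB mD.
have f0 := kernel_ge0 p B D.
rewrite (@fubini_tonelli _ _ (T * T)%type T R gam leb _ mf f0).
apply: eq_integral => w _.
have mpG : measurable (p @^-1` Gs w).
  by rewrite -[X in measurable X]setTI; exact: mp.
rewrite -[X in gam X]setIT -integral_indic//; last exact: measurableI.
have mI : measurable_fun [set: T * T] (fun z => (\1_(D `&` p @^-1` Gs w) z : R)%:E).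
  by apply/measurable_EFinP; apply: measurable_indic; exact: measurableI.
have B0 : (0 <= (\1_B w : R)%:E)%E by rewrite lee_fin.
rewrite -(ge0_integralZl gam measurableT mI _ B0); last first.
  by move=> z _; rewrite lee_fin.
by apply: eq_integral => z _; rewrite -EFinM indicI.
Qed.

Let gam_fst w : gam (fst @^-1` Gs w) = (\int[mu]_x (\1_G x * u (x + r *: w)%R)%:E)%E.
Proof.
rewrite (cgam (measurable_Gs w)).1 integral_mkcond.
rewrite -(ge0_torus_integral_shift (r *: w) L0 (f := (fun x => (u x)%:E) \_ (Gs w))).
- apply: eq_integral => x _; rewrite patchE indicE /=.
  have -> : (x + r *: w \in Gs w) = (x \in G).
    by apply/idP/idP; rewrite !inE /Gs/= addrK.
  by case: (x \in G); rewrite ?mul1r ?mul0r.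
- apply/(measurable_restrictT _ (measurable_Gs w)).
  by apply/measurable_EFinP; exact: measurable_funS mu_.
- by apply: erestrict_ge0 => x _; rewrite lee_fin.
- move=> i x; rewrite !patchE pu.
  have -> : (x + L *: delta_mx 0 i \in Gs w) = (x \in Gs w) => //.
  by apply/idP/idP; rewrite !inE /Gs/= addrAC pG.
Qed.

Let gam_snd w : gam (snd @^-1` Gs w) = mu G.
Proof.
rewrite (cgam (measurable_Gs w)).2 integral_mkcond.
rewrite -(ge0_torus_integral_shift (r *: w) L0 (f := (fun x => (cst 1 x)%:E) \_ (Gs w))).
- rewrite -[X in mu X]setIT -integral_indic//.
  apply: eq_integral => x _; rewrite patchE indicE /=.
  have -> : (x + r *: w \in Gs w) = (x \in G).
    by apply/idP/idP; rewrite !inE /Gs/= addrK.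
  by case: (x \in G).
- apply/(measurable_restrictT _ (measurable_Gs w)).
  exact: (@measurable_cst _ _ _ _ (Gs w) (1%E : \bar R)).
- by apply: erestrict_ge0 => x _; rewrite lee_fin.
- move=> i x; rewrite !patchE.
  have -> : (x + L *: delta_mx 0 i \in Gs w) = (x \in Gs w) => //.
  by apply/idP/idP; rewrite !inE /Gs/= addrAC pG.
Qed.

Let measurable_near : measurable near.
Proof.
have := @measurable_torus_dist R n L measurableT `]-oo, rho[%classic (measurable_itv _).
by congr measurable; apply/seteqP; split => z /=; rewrite in_itv/= => // -[].
Qed.

Let measurable_far : measurable far.
Proof.
have := @measurable_torus_dist R n L measurableT `[rho, +oo[%classic (measurable_itv _).
by congr measurable; apply/seteqP; split => z /=; rewrite in_itv/= andbT => // -[].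
Qed.

Let measurable_big_cube : measurable big_cube.
Proof.
have := @measurable_shift R n (const_mx a) measurableT _ (measurable_cube (1 + 2 * a)).
by rewrite setTI.
Qed.

Let leb_big_cube : leb big_cube = ((1 + 2 * a) ^+ n)%:E.
Proof.
rewrite -lebesgue_cube; last by have := a0; lra.
rewrite -[X in leb X = _]setIT -[X in _ = leb X]setIT -!integral_indic//; last exact: measurable_cube.
rewrite -[RHS](ge0_integral_shift (const_mx a)).
- by apply: eq_integral => x _; rewrite !indicE.
- by apply/measurable_EFinP; apply: measurable_indic; exact: measurable_cube.
- by move=> x; rewrite lee_fin.
Qed.

Let coordDZ (x y : T) (c : R) i : (x + c *: y) 0 i = x 0 i + c * y 0 i.
Proof. by rewrite !mxE. Qed.

(** If the endpoints x, y of a move are closer than rho, the offsets w in the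
    unit cube that put x in Gs w become, after a translation by at most
    rho / r in each coordinate, offsets in the cube of side 1 + 2 rho / r that
    put y in Gs w. *)
Let unit_le_big z : near z ->
  (\int[leb]_w (\1_unit_cube w * \1_(Gs w) z.1)%:E <=
   \int[leb]_w (\1_big_cube w * \1_(Gs w) z.2)%:E)%E.
Proof.
move=> /torus_dist_lt[k zk].
set v := z.1 - z.2 + L *: map_mx intr k in zk.
have vi i : `|v 0 i| < rho.
  apply: le_lt_trans zk; rewrite /euclidean_norm -sqrtr_sqr ler_wsqrtr//.
  by rewrite (bigD1 i)//= lerDl sumr_ge0// => j _; rewrite sqr_ge0.
have z1 : z.1 = (z.2 + v) - L *: map_mx intr k.
  by rewrite /v addrA subrKC addrK.
have GsE w : Gs w z.1 = G (z.2 + v - r *: w).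
  rewrite /Gs/= z1 -(lattice_periodic_int k _ pG); congr G.
  by rewrite addrAC subrK.
have mGs (x : T) : measurable [set w : T | G (x - r *: w)].
  have m : measurable_fun [set: T] (fun w : T => x - r *: w).
    apply: measurable_fun_rVP => i.
    rewrite (_ : (fun w => _) = (fun w : T => x 0 i - r * w 0 i)); last first.
      by apply/funext => w; rewrite !mxE.
    apply: measurable_funB => //; apply: measurable_funM => //.
    exact: measurable_coor.
  by have := m measurableT _ mG; rewrite setTI.
have mE (B : set T) x : measurable B ->
    measurable_fun [set: T] (fun w => (\1_B w * \1_[set w : T | G (x - r *: w)] w : R)%:E).
  by move=> mB; apply/measurable_EFinP; apply: measurable_funM; exact: measurable_indic.
have -> : (\int[leb]_w (\1_unit_cube w * \1_(Gs w) z.1)%:E =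
    \int[leb]_w (\1_unit_cube w * \1_[set w : T | G ((z.2 + v) - r *: w)] w)%:E)%E.
  apply: eq_integral => w _; congr (_ * _)%:E; rewrite !indicE; congr (nat_of_bool _)%:R.
  by apply/idP/idP; rewrite !inE/= GsE.
have -> : (\int[leb]_w (\1_big_cube w * \1_(Gs w) z.2)%:E =
    \int[leb]_w (\1_big_cube w * \1_[set w : T | G (z.2 - r *: w)] w)%:E)%E.
  by apply: eq_integral => w _; congr (_ * _)%:E; rewrite !indicE.
have mU : measurable unit_cube by exact: measurable_cube.
(* The offsets are translated by v / r, whose coordinates are below rho / r. *)
rewrite -(ge0_integral_shift (r^-1 *: v)); first last.
- by move=> w; rewrite lee_fin mulr_ge0.
- exact: mE.
apply: ge0_le_integral => //.
- exact: measurableT_comp (mE _ _ mU) (measurable_shift _).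
- exact: mE.
move=> w _; rewrite lee_fin.
have -> : \1_[set w : T | G ((z.2 + v) - r *: w)] (w + r^-1 *: v) =
    \1_[set w : T | G (z.2 - r *: w)] w :> R.
  rewrite !indicE; congr (nat_of_bool _)%:R; apply/idP/idP; rewrite !inE/=.
    by rewrite scalerDr scalerA divff ?gt_eqF// scale1r opprD addrACA (addrC v) addrA addrNK.
  by rewrite scalerDr scalerA divff ?gt_eqF// scale1r opprD addrACA (addrC v) addrA addrNK.
rewrite ler_wpM2r// !indicE ler_nat.
case: (boolP (w + r^-1 *: v \in unit_cube)) => // /[!inE] H; rewrite mem_set// => i.
have := H i; rewrite coordDZ (_ : (w + const_mx a) ord0 i = w 0 i + a); last by rewrite !mxE.
have : `|r^-1 * v 0 i| <= a.
  by rewrite normrM gtr0_norm ?invr_gt0// mulrC ler_wpM2r ?invr_ge0 ?ltW.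
rewrite ler_norml; set b := r^-1 * _; lra.
Qed.

(** The mass of u near G is either moved farther than rho, or it lands near G.
    Integrating [unit_le_big] against the plan, the second part is at most the
    volume of G times the number (1 + 2 rho / r) ^ n of admissible offsets.
    Only w is translated and Fubini does the rest, so no covering argument and
    no neighbourhood of G appear. *)
Lemma transport_bound :
  (\int[torus_measure 1]_w \int[mu]_x (\1_G x * u (x + r *: w)%R)%:E <=
   ((1 + 2 * (rho / r)) ^+ n)%:E * mu G + gam far)%E.
Proof.
have mU : measurable unit_cube by exact: measurable_cube.
have mgam (D : set (T * T)) (B : set T) (p : T * T -> T) : measurable D -> measurable B ->
    measurable_fun [set: T * T] p ->
    measurable_fun [set: T] (fun w => ((\1_B w)%:E * gam (D `&` p @^-1` Gs w))%E).
  move=> mD mB mp; apply: emeasurable_funM.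
    by apply/measurable_EFinP; exact: measurable_indic.
  have mGp : measurable [set zw : (T * T) * T | D zw.1 /\ G (p zw.1 - r *: zw.2)].
    apply: measurableI.
      by have := @measurable_fst _ _ (T * T)%type T measurableT _ mD; rewrite setTI.
    by have := measurable_shift_scale mp measurableT mG; rewrite setTI.
  have := measurable_fun_ysection gam mGp.
  by congr measurable_fun; apply/funext => w /=; congr (gam _); apply/seteqP; split => z; rewrite /ysection/= inE.
have split w : ((\1_unit_cube w)%:E * gam (fst @^-1` Gs w) <=
    (\1_unit_cube w)%:E * gam (near `&` fst @^-1` Gs w) + (\1_unit_cube w)%:E * gam far)%E.
  rewrite -ge0_muleDr ?measure_ge0//; apply: lee_wpmul2l; first by rewrite lee_fin.
  have mfG : measurable (fst @^-1` Gs w : set (T * T)).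
    by rewrite -[X in measurable X]setTI; apply: measurable_fst.
  apply: (@le_trans _ _ (gam ((near `&` fst @^-1` Gs w) `|` far))).
    apply: le_measure; rewrite ?inE//.
      by apply: measurableU => //; exact: measurableI.
    move=> z Gz; have [zr|zr] := ltP (torus_dist L z.1 z.2) rho; first by left.
    by right.
  by apply: measureU2 => //; exact: measurableI.
rewrite torus_integralE; first last.
- by move=> w; apply: integral_ge0 => x _; rewrite lee_fin mulr_ge0.
- have := mgam setT setT fst measurableT measurableT measurable_fst.
  congr measurable_fun; apply/funext => w.
  by rewrite indicT mul1e setTI gam_fst.
rewrite integral_mkcond.
rewrite (eq_integral (fun w => (\1_unit_cube w)%:E * gam (fst @^-1` Gs w))%E); last first.
  move=> w _; rewrite patchE indicE gam_fst /unit_cube.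
  by case: (w \in _); rewrite ?mul1e ?mul0e.
apply: (@le_trans _ _ (\int[leb]_w ((\1_unit_cube w)%:E * gam (near `&` fst @^-1` Gs w)
     + (\1_unit_cube w)%:E * gam far))%E).
  apply: ge0_le_integral => //.
  - by move=> w _; rewrite mule_ge0 ?lee_fin.
  - have := mgam setT unit_cube fst measurableT mU measurable_fst.
    by congr measurable_fun; apply/funext => w; rewrite setTI.
  - apply: emeasurable_funD; first exact: mgam.
    by apply: emeasurable_funM => //; apply/measurable_EFinP; exact: measurable_indic.
rewrite ge0_integralD//; first last.
- by apply: emeasurable_funM => //; apply/measurable_EFinP; exact: measurable_indic.
- by move=> w _; rewrite mule_ge0 ?lee_fin.
- exact: mgam.
- by move=> w _; rewrite mule_ge0 ?lee_fin.
apply: leeD; last first.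
  rewrite ge0_integralZr//; last first.
    by apply/measurable_EFinP; exact: measurable_indic.
  have leb_unit : leb unit_cube = 1%E by rewrite /unit_cube lebesgue_cube// expr1n.
  by rewrite integral_indic// setIT [X in (X * _)%E]leb_unit mul1e.
rewrite (fubini_Gs measurable_fst mU measurable_near).
have -> : (((1 + 2 * (rho / r)) ^+ n)%:E * mu G =
    \int[leb]_w ((\1_big_cube w)%:E * gam (setT `&` snd @^-1` Gs w)))%E.
  rewrite (eq_integral (fun w => (\1_big_cube w)%:E * mu G)%E); last first.
    by move=> w _; rewrite setTI gam_snd.
  rewrite ge0_integralZr//; last first.
    by apply/measurable_EFinP; exact: measurable_indic.
  by rewrite integral_indic// setIT [X in (_ = X * _)%E]leb_big_cube.
rewrite [X in (_ <= X)%E](fubini_Gs measurable_snd measurable_big_cube measurableT).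
apply: ge0_le_integral => //.
- by move=> z _; apply: integral_ge0 => w _; exact: (kernel_ge0 fst unit_cube near (z, w)).
- exact: (@measurable_fun_fubini_tonelli_F _ _ _ _ _ leb _
    (measurable_kernel measurable_fst mU measurable_near) (kernel_ge0 _ _ _)).
- exact: (@measurable_fun_fubini_tonelli_F _ _ _ _ _ leb _
    (measurable_kernel measurable_snd measurable_big_cube measurableT) (kernel_ge0 _ _ _)).
move=> z _; have [zn|zn] := pselect (near z); last first.
  rewrite integral0_eq => [|w _].
    by apply: integral_ge0 => w _; exact: (kernel_ge0 snd big_cube setT (z, w)).
  by rewrite [\1_near z]indicE memNset// mul0r mulr0.
under eq_integral do rewrite [\1_near z]indicE mem_set// mul1r.
under [leRHS]eq_integral do rewrite indicT mul1r.
exact: unit_le_big.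
Qed.

End transport.

(** * The measure of one level set *)

Section level.
Context {R : realType} {n : nat} (L : R).
Local Notation T := ('rV[R]_n).
Local Notation mu := (@torus_measure R n L).
Local Notation om := (@torus_measure R n 1).
Variables (u : T -> R) (gam : {finite_measure set (T * T)%type -> \bar R}).
Hypothesis L0 : 0 < L.
Hypothesis mu_ : measurable_fun [set: T] u.
Hypothesis pu : lattice_periodic L u.
Hypothesis u0 : forall x, 0 <= u x.
Hypothesis cgam : coupling L u (cst 1) gam.
Variables (c c' r rho : R).
Hypothesis c0 : 0 < c.
Hypothesis cc' : c < c'.
Hypothesis r0 : 0 < r.
Hypothesis rho0 : 0 <= rho.
Hypothesis spread : (1 + 2 * (rho / r)) ^+ n <= (c' - c) / 4.

(** Written as a difference of two minima, consecutive slices telescope. *)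
Definition slice (c c' t : R) := Num.min t c' - Num.min t c.

Lemma slice_ge0 t : 0 <= slice c c' t.
Proof. by rewrite /slice; case: (leP t c'); case: (leP t c); have := cc'; lra. Qed.

Lemma slice_le t : 0 <= t -> slice c c' t <= t.
Proof. by rewrite /slice; case: (leP t c'); case: (leP t c); have := cc'; have := c0; lra. Qed.

Lemma slice_top t : c' <= t -> slice c c' t = c' - c.
Proof. by rewrite /slice; case: (leP t c'); case: (leP t c); have := cc'; lra. Qed.

Let U x := slice c c' (u x).
Let delta := c' - c.

Lemma measurable_slice : measurable_fun [set: T] (fun x => slice c c' (u x)).
Proof. by apply: measurable_funB; apply: measurable_minr. Qed.

Lemma measurable_add_scale (k : R) :
  measurable_fun [set: T * T] (fun xw : T * T => xw.1 + k *: xw.2).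
Proof.
apply: measurable_fun_rVP => i.
rewrite (_ : (fun x => _) = (fun xw : T * T => xw.1 0 i + k * xw.2 0 i)); last first.
  by apply/funext => z; rewrite !mxE.
apply: measurable_funD.
  exact: measurableT_comp (measurable_coor i) measurable_fst.
apply: measurable_funM => //.
exact: measurableT_comp (measurable_coor i) measurable_snd.
Qed.

Let avg x := (\int[om]_w (U (x + r *: w)%R)%:E)%E.

Let mUr : measurable_fun [set: T * T] (fun xw : T * T => (U (xw.1 + r *: xw.2))%:E).
Proof.
by apply/measurable_EFinP; exact: measurableT_comp measurable_slice (measurable_add_scale r).
Qed.

Let mavg : measurable_fun [set: T] avg.
Proof.
apply: (@measurable_fun_fubini_tonelli_F _ _ _ _ _ om _ mUr) => xw.
by rewrite lee_fin slice_ge0.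
Qed.

Let osc x := (\int[om]_w `|U (x + r *: w) - U x|%:E)%E.

Let mdiff : measurable_fun [set: T * T]
  (fun xw : T * T => `|U (xw.1 + r *: xw.2) - U xw.1|%:E).
Proof.
apply/measurable_EFinP; apply: measurableT_comp => //; apply: measurable_funB.
  exact: measurableT_comp measurable_slice (measurable_add_scale r).
exact: measurableT_comp measurable_slice measurable_fst.
Qed.

Let F := [set x : T | c' <= u x].
Let G := [set x : T | ((delta / 2)%:E < avg x)%E].

Let mF : measurable F.
Proof.
have := @mu_ measurableT `[c', +oo[%classic (measurable_itv _).
by congr measurable; apply/seteqP; split => x /=; rewrite in_itv/= andbT => // -[].
Qed.

Let mG : measurable G.
Proof.
rewrite -[X in measurable X]setTI; exact: emeasurable_fun_o_infty.
Qed.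

Let pG : lattice_periodic L G.
Proof.
move=> i x; rewrite /G /=; congr (_ < _)%E.
by apply: eq_integral => w _; rewrite addrAC /U pu.
Qed.

Let omT : om setT = 1%E. Proof. by rewrite torus_measureT// expr1n. Qed.

Let d0 : 0 < delta. Proof. by rewrite subr_gt0. Qed.

(** At a point of F outside G the slice takes its maximal value delta while its
    average is at most delta / 2, so its mean oscillation is at least
    delta / 2. *)
Let low_part : ((delta / 2)%:E * mu (F `\` G) <= \int[mu]_x osc x)%E.
Proof.
have mFG : measurable (F `\` G) by exact: measurableD.
have mosc : measurable_fun [set: T] osc.
  by apply: (@measurable_fun_fubini_tonelli_F _ _ _ _ _ om _ mdiff) => xw; rewrite lee_fin.
rewrite -[X in mu X]setIT -integral_indic// -ge0_integralZl//; first last.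
- by rewrite lee_fin divr_ge0// ltW.
- by apply/measurable_EFinP; exact: measurable_indic.
apply: ge0_le_integral => //.
- by move=> x _; rewrite mule_ge0// lee_fin// divr_ge0// ltW.
- by apply: emeasurable_funM => //; apply/measurable_EFinP; exact: measurable_indic.
move=> x _; rewrite indicE.
have [xFG|xFG] := pselect ((F `\` G) x); last first.
  by rewrite memNset// mule0; exact: integral_ge0.
rewrite mem_set// mule1; case: xFG => xF /negP; rewrite -leNgt => xG.
have mUx : measurable_fun [set: T] (fun w => (U (x + r *: w))%:E).
  exact: (measurableT_comp mUr (pair1_measurable x)).
have mdx : measurable_fun [set: T] (fun w => `|U (x + r *: w) - U x|%:E).
  exact: (measurableT_comp mdiff (pair1_measurable x)).
(* Pointwise in w, delta = U x <= |U (x + r w) - U x| + U (x + r w). *)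
have : (delta%:E <= osc x + avg x)%E.
  rewrite -ge0_integralD//; last by move=> w _; rewrite lee_fin slice_ge0.
  rewrite -[leLHS]mule1 -omT -integral_cst//; apply: ge0_le_integral => //.
  - by move=> w _; rewrite lee_fin ltW.
  - exact: emeasurable_funD.
  - move=> w _; rewrite -EFinD lee_fin {2}/U slice_top// -/delta.
    have := ler_norm (- (U (x + r *: w) - delta)); rewrite normrN.
    set a := `|_|; lra.
move=> H; rewrite -(@leeD2rE _ (delta / 2)%:E)// -EFinD -splitr.
by apply: le_trans H _; exact: leeD2l.
Qed.

(** On G the average of u over the cube exceeds delta / 2, the slice being below
    u.  By [transport_bound] and the hypothesis on rho / r, at most delta / 4
    per unit of volume can stay within rho, so the other half travels far. *)
Let high_part : ((delta / 2)%:E * mu G <= 2%:E * gam [set z : T * T | (rho <= torus_dist L z.1 z.2)%R])%E.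
Proof.
set g := gam _.
have g_fin : g \is a fin_num.
  apply: fin_num_measure.
  have := @measurable_torus_dist R n L measurableT `[rho, +oo[%classic (measurable_itv _).
  by congr measurable; apply/seteqP; split => z /=; rewrite in_itv/= andbT => // -[].
have m_fin : mu G \is a fin_num by exact: torus_measure_fin.
have H : ((delta / 2)%:E * mu G <= ((1 + 2 * (rho / r)) ^+ n)%:E * mu G + g)%E.
  apply: le_trans (transport_bound L0 mu_ pu u0 cgam mG pG r0 rho0).
  have mGu : measurable_fun [set: T * T]
      (fun xw : T * T => (\1_G xw.1 * u (xw.1 + r *: xw.2) : R)%:E).
    apply/measurable_EFinP; apply: measurable_funM.
      have mG1 : measurable_fun [set: T] (\1_G : T -> R) by exact: measurable_indic.
      exact: measurableT_comp mG1 measurable_fst.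
    exact: measurableT_comp mu_ (measurable_add_scale r).
  have Gu0 (xw : T * T) : (0 <= (\1_G xw.1 * u (xw.1 + r *: xw.2) : R)%:E)%E.
    by rewrite lee_fin mulr_ge0.
  rewrite -(@fubini_tonelli _ _ T T R mu om _ mGu Gu0).
  rewrite -[X in mu X]setIT -integral_indic// -ge0_integralZl//; first last.
  - by rewrite lee_fin divr_ge0// ltW.
  - by apply/measurable_EFinP; exact: measurable_indic.
  apply: ge0_le_integral => //.
  - by move=> x _; rewrite mule_ge0// lee_fin// divr_ge0// ltW.
  - by apply: emeasurable_funM => //; apply/measurable_EFinP; exact: measurable_indic.
  - exact: (@measurable_fun_fubini_tonelli_F _ _ _ _ _ om _ mGu Gu0).
  move=> x _ /=; have [xG|xG] := pselect (G x); last first.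
    rewrite [X in (_ * X)%E](_ : _ = 0%E); last by rewrite indicE memNset.
    by rewrite mule0; apply: integral_ge0 => w _; exact: (Gu0 (x, w)).
  rewrite [X in (_ * X)%E](_ : _ = 1%E); last by rewrite indicE mem_set.
  rewrite mule1; apply: le_trans (ltW xG) _.
  apply: ge0_le_integral => //.
  - by move=> w _; rewrite lee_fin slice_ge0.
  - exact: (measurableT_comp mUr (pair1_measurable x)).
  - exact: (measurableT_comp mGu (pair1_measurable x)).
  - by move=> w _; rewrite lee_fin indicE mem_set// mul1r slice_le.
move: H; rewrite -(fineK m_fin) -(fineK g_fin) -!EFinM -EFinD !lee_fin.
have m0 : 0 <= fine (mu G) by rewrite fine_ge0.
have := ler_wpM2r m0 spread; rewrite -/delta.
set a := _ ^+ n; set m := fine _; set g' := fine g.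
have -> : delta / 4 * m = (delta * m) / 4 by field.
have -> : delta / 2 * m = (delta * m) / 2 by field.
lra.
Qed.

Lemma level_bound :
  (((c' - c) / 2)%:E * mu [set x : T | (c' <= u x)%R] <=
   \int[om]_w \int[mu]_x `|slice c c' (u (x + r *: w)) - slice c c' (u x)|%:E +
   2%:E * gam [set z : T * T | (rho <= torus_dist L z.1 z.2)%R])%E.
Proof.
rewrite -(@fubini_tonelli _ _ T T R mu om _ mdiff); last by move=> xw; rewrite lee_fin.
apply: le_trans (leeD low_part high_part).
rewrite -ge0_muleDr ?measure_ge0//; apply: lee_wpmul2l.
  by rewrite lee_fin divr_ge0// ltW.
apply: (@le_trans _ _ (mu ((F `\` G) `|` G))).
  apply: le_measure; rewrite ?inE//.
    by apply: measurableU => //; exact: measurableD.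
  by move=> x xF; have [xG|xG] := pselect (G x); [right|left].
by apply: measureU2 => //; exact: measurableD.
Qed.

End level.

(** * Summation over levels and scales *)

Section oscillation.
Context {R : realType} {n : nat} (L : R).
Local Notation T := ('rV[R]_n).
Local Notation mu := (@torus_measure R n L).
Local Notation om := (@torus_measure R n 1).
Variable u : T -> R.
Hypothesis L0 : 0 < L.
Hypothesis mu_ : measurable_fun [set: T] u.
Hypothesis pu : lattice_periodic L u.
Hypothesis u0 : forall x, 0 <= u x.
Hypothesis iu : mu.-integrable setT (EFin \o u).
Hypothesis V_fin : (torus_variation L u < +oo)%E.

Let measurable_osc (f : T -> R) (h : T) : measurable_fun [set: T] f ->
  measurable_fun [set: T] (fun x => `|f (x + h) - f x|%:E).
Proof.
move=> mf; apply/measurable_EFinP; apply: measurableT_comp => //.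
by apply: measurable_funB => //; exact: measurableT_comp mf (measurable_shift h).
Qed.

(** Triangle inequality along h, 2 h, ..., N h and translation invariance. *)
Lemma oscillation_multiple (f : T -> R) (h : T) (N : nat) :
  measurable_fun [set: T] f -> lattice_periodic L f ->
  (\int[mu]_x `|f (x + h *+ N) - f x|%:E <= N%:R%:E * \int[mu]_x `|f (x + h) - f x|%:E)%E.
Proof.
move=> mf pf; elim: N => [|N IH].
  rewrite mul0e integral0_eq// => x _.
  by rewrite mulr0n addr0 subrr normr0.
rewrite -natr1 EFinD ge0_muleDl ?lee_fin// mul1e.
apply: le_trans (leeD IH (lexx _)).
rewrite -[X in (_ <= _ + X)%E](ge0_torus_integral_shift (h *+ N) L0); first last.
- by move=> i x; rewrite addrAC !pf.
- by move=> x; rewrite lee_fin.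
- exact: measurable_osc.
rewrite -ge0_integralD//; first last.
- by have := measurableT_comp (measurable_osc h mf) (measurable_shift (h *+ N)).
- exact: measurable_osc.
apply: ge0_le_integral => //.
- exact: measurable_osc.
- apply: emeasurable_funD; first exact: measurable_osc.
  by have := measurableT_comp (measurable_osc h mf) (measurable_shift (h *+ N)).
move=> x _; rewrite -EFinD lee_fin mulrSr addrA [leRHS]addrC.
by apply: le_trans (ler_normD _ _); rewrite addrA subrK.
Qed.

(** Slices are monotone in their argument, so for b <= a all differences are
    nonnegative and telescope. *)
Lemma slice_sum (c : nat -> R) (a b : R) (K : nat) :
  (forall k, c k <= c k.+1) ->
  \sum_(k < K) `|slice (c k) (c k.+1) a - slice (c k) (c k.+1) b| <= `|a - b|.
Proof.
move=> cS; wlog ba : a b / b <= a.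
  move=> H; have [|/ltW ab] := leP b a; first exact: H.
  by rewrite distrC (eq_bigr _ (fun k _ => distrC _ _)); exact: H.
rewrite (ger0_norm (_ : 0 <= a - b)) ?subr_ge0//.
apply: (@le_trans _ _ ((Num.min a (c K) - Num.min b (c K)) - (Num.min a (c 0%N) - Num.min b (c 0%N)))).
  elim: K => [|K IH]; first by rewrite big_ord0 subrr.
  rewrite big_ord_recr/=.
  have -> : `|slice (c K) (c K.+1) a - slice (c K) (c K.+1) b| =
      slice (c K) (c K.+1) a - slice (c K) (c K.+1) b.
    apply: ger0_norm; rewrite subr_ge0 /slice; have := cS K.
    by case: (leP a (c K)); case: (leP a (c K.+1)); case: (leP b (c K)); case: (leP b (c K.+1)); lra.
  move: IH; rewrite /slice; lra.
by case: (leP a (c K)); case: (leP b (c K)); case: (leP a (c 0%N)); case: (leP b (c 0%N)); lra.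
Qed.

Lemma oscillation_slice_sum (c : nat -> R) (h : T) (K : nat) :
  (forall k, c k <= c k.+1) ->
  (\sum_(k < K) \int[mu]_x
     `|slice (c k) (c k.+1) (u (x + h)%R) - slice (c k) (c k.+1) (u x)|%:E <=
   (euclidean_norm h)%:E * torus_variation L u)%E.
Proof.
move=> cS; apply: le_trans (variation_shift L0 mu_ pu u0 iu V_fin h).
have ms k : measurable_fun [set: T] (fun x => slice (c k) (c k.+1) (u x)).
  exact: measurable_slice.
rewrite -ge0_integral_sum//; last by move=> k; exact: measurable_osc (ms k).
apply: ge0_le_integral => //.
- by move=> x _; apply: sume_ge0.
- by apply: emeasurable_sum => k; exact: measurable_osc (ms k).
- exact: measurable_osc.
- by move=> x _; rewrite sumEFin lee_fin; exact: slice_sum.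
Qed.

Lemma euclidean_norm_unit_cube (w : T) : cube 1 w -> euclidean_norm w <= n%:R.
Proof.
move=> w1; rewrite /euclidean_norm -[leRHS]ger0_norm// -sqrtr_sqr ler_wsqrtr//.
apply: (@le_trans _ _ (\sum_(i < n) 1)).
  apply: ler_sum => i _; have /andP[wi0 wi1] := w1 i.
  by rewrite expr_le1.
rewrite sumr_const card_ord -natrX ler_nat.
by case: n => // m; rewrite leq_pmulr.
Qed.

Let measurable_osc2 (f : T -> R) (r : R) : measurable_fun [set: T] f ->
  measurable_fun [set: T * T] (fun xw : T * T => `|f (xw.1 + r *: xw.2) - f xw.1|%:E).
Proof.
move=> mf; apply/measurable_EFinP; apply: measurableT_comp => //; apply: measurable_funB.
  exact: measurableT_comp mf (measurable_add_scale r).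
exact: measurableT_comp mf measurable_fst.
Qed.

(** The lengths A / 4 ^ (k + 1) are integer multiples of the smallest one,
    rho = A / 4 ^ K.  By [oscillation_multiple] each weighted oscillation is at
    most 4 ^ K times the oscillation of the same slice at scale rho, and at a
    common scale the slices add up to the oscillation of u itself.  The factor
    n bounds the Euclidean norm on the unit cube. *)
Lemma multiscale_oscillation (c : nat -> R) (A : R) (K : nat) : 0 < A ->
  (forall k, c k <= c k.+1) ->
  (\sum_(k < K) (4 ^+ k.+1)%:E * \int[om]_w \int[mu]_x
     `|slice (c k) (c k.+1) (u (x + (A / 4 ^+ k.+1) *: w)%R) -
       slice (c k) (c k.+1) (u x)|%:E <=
   (A * n%:R)%:E * torus_variation L u)%E.
Proof.
move=> A0 cS; set rho := A / 4 ^+ K.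
have V0 := torus_variation_ge0 L u.
pose osc k (h : T) := (\int[mu]_x
  `|slice (c k) (c k.+1) (u (x + h)%R) - slice (c k) (c k.+1) (u x)|%:E)%E.
have ms k : measurable_fun [set: T] (fun x => slice (c k) (c k.+1) (u x)).
  exact: measurable_slice.
have osc0 k h : (0 <= osc k h)%E by apply: integral_ge0 => x _; rewrite lee_fin.
have mosc k r : measurable_fun [set: T] (fun w => osc k (r *: w)).
  apply: (@measurable_fun_fubini_tonelli_G _ _ _ _ _ mu _ (measurable_osc2 r (ms k))).
  by move=> xw; rewrite lee_fin.
have Zosc (b : R) k r : 0 <= b ->
    (b%:E * \int[om]_w osc k (r *: w) = \int[om]_w (b%:E * osc k (r *: w)))%E.
  by move=> b0; rewrite ge0_integralZl//; exact: mosc.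
have step k w : (k < K)%N ->
    ((4 ^+ k.+1)%:E * osc k ((A / 4 ^+ k.+1) *: w) <= (4 ^+ K)%:E * osc k (rho *: w))%E.
  move=> kK.
  have -> : (A / 4 ^+ k.+1) *: w = (rho *: w) *+ (4 ^ (K - k.+1))%N.
    rewrite -scaler_nat scalerA natrX /rho; congr (_ *: _).
    rewrite -[in 4 ^+ K](subnK kK) exprD; field.
    by rewrite !expf_neq0.
  apply: (@le_trans _ _ ((4 ^+ k.+1)%:E * ((4 ^ (K - k.+1))%N%:R%:E * osc k (rho *: w)))%E).
    apply: lee_wpmul2l; first by rewrite lee_fin exprn_ge0.
    apply: (oscillation_multiple (f := fun x => slice (c k) (c k.+1) (u x))) => //.
    by move=> i x; rewrite pu.
  by rewrite muleA -EFinM natrX -exprD subnKC.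
apply: (@le_trans _ _ (\sum_(k < K) (4 ^+ K)%:E * \int[om]_w osc k (rho *: w))%E).
  apply: lee_sum => -[k kK] _ /=.
  have E1 := Zosc (4 ^+ k.+1) k (A / 4 ^+ k.+1) (exprn_ge0 _ (ler0n _ 4)).
  have E2 := Zosc (4 ^+ K) k rho (exprn_ge0 _ (ler0n _ 4)).
  rewrite [leLHS]E1 [leRHS]E2; apply: ge0_le_integral => //.
  - by move=> w _; rewrite mule_ge0// lee_fin exprn_ge0.
  - by apply: emeasurable_funM => //; exact: mosc.
  - by apply: emeasurable_funM => //; exact: mosc.
  - by move=> w _; exact: step.
rewrite -ge0_sume_distrr//; last by move=> k _; apply: integral_ge0.
rewrite -ge0_integral_sum//.
have msum : measurable_fun [set: T] (fun w => \sum_(k < K) osc k (rho *: w))%E.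
  by apply: emeasurable_sum => k; exact: mosc.
rewrite torus_integralE//; last by move=> w; exact: sume_ge0.
have mC := measurable_cube (n := n) (1 : R).
have rho0 : 0 < rho by rewrite divr_gt0// exprn_gt0.
apply: (@le_trans _ _ ((4 ^+ K)%:E * \int[@lebesgue_rV R n]_(w in cube 1)
     ((rho * n%:R)%:E * torus_variation L u))%E).
  apply: lee_wpmul2l; first by rewrite lee_fin exprn_ge0.
  apply: ge0_le_integral => //.
  - by move=> w _; exact: sume_ge0.
  - exact: measurable_funS msum.
  move=> w w1; apply: le_trans (oscillation_slice_sum _ _ cS) _.
  apply: lee_wpmul2r => //; rewrite lee_fin euclidean_normZ gtr0_norm// ler_wpM2l ?(ltW rho0)//.
  exact: euclidean_norm_unit_cube.
have leb_unit : @lebesgue_rV R n (cube 1) = 1%E by rewrite lebesgue_cube// expr1n.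
rewrite integral_cst// [X in (_ * (_ * X))%E]leb_unit mule1 muleA -EFinM.
rewrite (_ : 4 ^+ K * (rho * n%:R) = A * n%:R)// /rho; field.
by rewrite expf_neq0.
Qed.

End oscillation.

Section summation.
Context {R : realType} {n : nat} (L : R).
Local Notation T := ('rV[R]_n).
Local Notation mu := (@torus_measure R n L).
Local Notation om := (@torus_measure R n 1).
Variables (u : T -> R) (gam : {finite_measure set (T * T)%type -> \bar R}).
Hypothesis n0 : (0 < n)%N.
Hypothesis L0 : 0 < L.
Hypothesis mu_ : measurable_fun [set: T] u.
Hypothesis pu : lattice_periodic L u.
Hypothesis u0 : forall x, 0 <= u x.
Hypothesis iu : mu.-integrable setT (EFin \o u).
Hypothesis V_fin : (torus_variation L u < +oo)%E.
Hypothesis cgam : coupling L u (cst 1) gam.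
Variable A : R.
Hypothesis A0 : 0 < A.

(** A geometric sum is comparable to its last term. *)
Lemma geometric_count (t : R) (K : nat) : 0 <= t ->
  \sum_(k < K) (if 2 ^+ k.+1 <= t then 4 ^+ k.+1 else 0) <= 4 / 3 * t ^+ 2.
Proof.
move=> t0.
pose S K : R := \sum_(k < K) (if 2 ^+ k.+1 <= t then 4 ^+ k.+1 else 0).
(* The bound by 4 / 3 * 4 ^ K is what the induction step uses when its term is
   present, the other one when it is absent. *)
suff /andP[] : (S K <= 4 / 3 * t ^+ 2) && (S K <= 4 / 3 * 4 ^+ K) by [].
elim: K => [|K /andP[IH1 IH2]].
  by rewrite /S big_ord0; apply/andP; split; rewrite mulr_ge0 ?sqr_ge0 ?exprn_ge0.
have p4 : 0 < 4 ^+ K :> R by rewrite exprn_gt0.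
rewrite /S big_ord_recr/= -/(S K); case: ifPn => [Kt|_]; last first.
  by rewrite addr0 IH1 [4 ^+ K.+1]exprS/=; lra.
have : 4 ^+ K.+1 <= t ^+ 2.
  have -> : 4 ^+ K.+1 = (2 ^+ K.+1) ^+ 2 :> R by rewrite -exprM mulnC exprM; congr (_ ^+ _); ring.
  by rewrite lerXn2r ?nnegrE ?exprn_ge0.
by rewrite [4 ^+ K.+1]exprS => H; apply/andP; split; lra.
Qed.

Let far k : set (T * T) := [set z | A * 2 ^+ k.+1 / 4 <= torus_dist L z.1 z.2].

Let measurable_far k : measurable (far k).
Proof.
have := @measurable_torus_dist R n L measurableT `[A * 2 ^+ k.+1 / 4, +oo[%classic (measurable_itv _).
by congr measurable; apply/seteqP; split => z /=; rewrite in_itv/= andbT => // -[].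
Qed.

Let cost := (\int[gam]_z (torus_dist L z.1 z.2 ^+ 2)%:E)%E.

(** A pair at distance D is counted at all levels with
    2 ^ (k + 1) <= 4 D / A, which contribute (D / A) ^ 2 up to a constant. *)
Lemma far_sum K :
  (\sum_(k < K) (4 ^+ k.+1)%:E * gam (far k) <= (64 / 3 / A ^+ 2)%:E * cost)%E.
Proof.
have mdist2 : measurable_fun [set: T * T] (fun z : T * T => (torus_dist L z.1 z.2 ^+ 2)%:E).
  by apply/measurable_EFinP; apply: measurable_funX; exact: measurable_torus_dist.
have mterm k : measurable_fun [set: T * T] (fun z => (4 ^+ k.+1)%:E * (\1_(far k) z : R)%:E)%E.
  by apply: emeasurable_funM => //; apply/measurable_EFinP; exact: measurable_indic.
rewrite /cost -ge0_integralZl//; first last.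
- by rewrite lee_fin !divr_ge0// sqr_ge0.
- by move=> z _; rewrite lee_fin sqr_ge0.
have E k : ((4 ^+ k.+1)%:E * gam (far k) =
    \int[gam]_z ((4 ^+ k.+1)%:E * (\1_(far k) z : R)%:E))%E.
  rewrite ge0_integralZl//; last first.
    by apply/measurable_EFinP; exact: measurable_indic.
  by rewrite integral_indic// setIT.
rewrite (eq_bigr (fun k : 'I_K => (\int[gam]_z ((4 ^+ k.+1)%:E * (\1_(far k) z : R)%:E))%E));
  last by move=> k _; exact: E.
rewrite -ge0_integral_sum//.
apply: ge0_le_integral => //.
- by move=> z _; apply: sume_ge0 => k _; rewrite mule_ge0 ?lee_fin ?exprn_ge0.
- by apply: emeasurable_sum.
- exact: emeasurable_funM.
move=> z _; set D := torus_dist L z.1 z.2.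
have D0 : 0 <= D by exact: torus_dist_ge0.
rewrite -EFinM (eq_bigr (fun k : 'I_K => (if 2 ^+ k.+1 <= 4 * D / A then 4 ^+ k.+1 else 0)%:E)).
  rewrite sumEFin lee_fin.
  apply: le_trans (geometric_count K _) _; first by rewrite divr_ge0// ?mulr_ge0// ltW.
  rewrite le_eqVlt; apply/orP; left; apply/eqP; field.
  by rewrite gt_eqF.
move=> k _; rewrite -EFinM indicE; congr EFin.
have -> : (2 ^+ k.+1 <= 4 * D / A) = (A * 2 ^+ k.+1 / 4 <= D).
  by rewrite ler_pdivlMr// ler_pdivrMr// mulrC [D * 4]mulrC.
case: ifPn => kD; first by rewrite mem_set// mulr1.
by rewrite memNset ?mulr0//; apply/negP.
Qed.

Let beta : R := 8 ^+ n.
Let c k : R := beta ^+ k.+1.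

Let beta8 : 8 <= beta.
Proof. by rewrite /beta -[leLHS]expr1 ler_eXn2l// ltr1n. Qed.

Let cS k : c k <= c k.+1.
Proof. by rewrite /c ler_eXn2l//; have := beta8; lra. Qed.

Let level k := [set x : T | (c k.+1 <= u x)%R].

Lemma level_sum K :
  (\sum_(k < K) (4 ^+ k.+1 * ((c k.+1 - c k) / 2))%:E * mu (level k) <=
   (A * n%:R)%:E * torus_variation L u + (128 / 3 / A ^+ 2)%:E * cost)%E.
Proof.
pose osc k := (\int[om]_w \int[mu]_x
     `|slice (c k) (c k.+1) (u (x + (A / 4 ^+ k.+1) *: w)%R) -
       slice (c k) (c k.+1) (u x)|%:E)%E.
have osc0 k : (0 <= osc k)%E.
  by apply: integral_ge0 => w _; apply: integral_ge0 => x _; rewrite lee_fin.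
have bd k : ((4 ^+ k.+1 * ((c k.+1 - c k) / 2))%:E * mu (level k) <=
    (4 ^+ k.+1)%:E * osc k + 2%:E * ((4 ^+ k.+1)%:E * gam (far k)))%E.
  have r0 : 0 < A / 4 ^+ k.+1 by rewrite divr_gt0// exprn_gt0.
  have rho0 : 0 <= A * 2 ^+ k.+1 / 4 by rewrite divr_ge0// mulr_ge0 ?exprn_ge0// ltW.
  have ck0 : 0 < c k by rewrite exprn_gt0//; have := beta8; lra.
  have cE : c k.+1 = beta * c k by rewrite /c exprS.
  have cc : c k < c k.+1 by rewrite cE; have := beta8; nra.
  (* rho / r = 8 ^ (k + 1) / 4, so the dilation factor is at most 8 ^ (k + 1),
     whose n-th power is the lower level c k. *)
  have spread : (1 + 2 * (A * 2 ^+ k.+1 / 4 / (A / 4 ^+ k.+1))) ^+ n <= (c k.+1 - c k) / 4.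
    have e8 : 8 ^+ k.+1 = 2 ^+ k.+1 * 4 ^+ k.+1 :> R by rewrite -exprMn; congr (_ ^+ _); ring.
    have -> : 1 + 2 * (A * 2 ^+ k.+1 / 4 / (A / 4 ^+ k.+1)) = 1 + 8 ^+ k.+1 / 2 :> R.
      by rewrite e8; field; rewrite (gt_eqF A0)/= andbT gt_eqF// exprn_gt0.
    apply: (@le_trans _ _ (c k)).
      rewrite /c /beta -exprM mulnC exprM lerXn2r ?nnegrE ?exprn_ge0//.
      have : 1 <= 8 ^+ k :> R by rewrite exprn_ege1// ler1n.
      by rewrite exprS; lra.
    by rewrite cE; have := beta8; nra.
  have := level_bound L0 mu_ pu u0 cgam ck0 cc r0 rho0 spread.
  rewrite -/(osc k) -/(far k) -/(level k) => H.
  rewrite EFinM -muleA (muleCA 2%:E) -ge0_muleDr//; last by rewrite mule_ge0.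
  by apply: lee_wpmul2l => //; rewrite lee_fin exprn_ge0.
apply: (@le_trans _ _ (\sum_(k < K) ((4 ^+ k.+1)%:E * osc k + 2%:E * ((4 ^+ k.+1)%:E * gam (far k))))%E).
  by apply: lee_sum => k _; exact: bd.
rewrite big_split/=; apply: leeD.
  exact: (multiscale_oscillation L0 mu_ pu u0 iu V_fin K A0 cS).
rewrite -ge0_sume_distrr; last by move=> k _; rewrite mule_ge0 ?lee_fin ?exprn_ge0.
have -> : 128 / 3 / A ^+ 2 = 2 * (64 / 3 / A ^+ 2) by field; rewrite gt_eqF.
by rewrite EFinM -muleA; apply: lee_wpmul2l; [rewrite lee_fin|exact: far_sum].
Qed.

Let p : R := (2 + 3 * n%:R) / (3 * n%:R).

Let nR0 : (0 : R) < n%:R. Proof. by rewrite ltr0n. Qed.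

Let p0 : 0 < p.
Proof. by rewrite divr_gt0 ?mulr_gt0// addr_gt0// mulr_gt0. Qed.

(** The exponent p is made for this: beta ^ (p - 1) = 8 ^ (2/3) = 4 pays for the
    weight 4 that each level receives. *)
Let beta_powR : beta `^ p = 4 * beta.
Proof.
have -> : p = 2 / (3 * n%:R) + 1 by rewrite /p; field; rewrite gt_eqF.
rewrite powRD ?gt_eqF ?implybT//; last by have := beta8; lra.
rewrite powRr1; last by have := beta8; lra.
congr (_ * _); have -> : beta = 2 `^ (3 * n%:R).
  rewrite -natrM powR_mulrn// exprM /beta; congr (_ ^+ _); ring.
rewrite -powRrM (_ : 3 * n%:R * _ = 2%:R); last by field; rewrite gt_eqF.
by rewrite powR_mulrn//; ring.
Qed.

(** If beta ^ (k + 2) <= u x < beta ^ (k + 3), the single level k already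
    carries the value (beta ^ (k + 3)) ^ p = (4 beta) ^ (k + 3).  Values of u
    below beta ^ 2 are removed by C. *)
Lemma excess_le_levels (C : R) x : beta ^+ 2 <= C ->
  ((Num.max (u x - C) 0 `^ p)%:E <=
   \sum_(0 <= k <oo) ((4 * beta) ^+ k.+3 * \1_(level k) x)%:E)%E.
Proof.
move=> bC; have b1 : 1 < beta by have := beta8; lra.
have w0 k : (0 <= ((4 * beta) ^+ k.+3 * \1_(level k) x)%:E)%E.
  by rewrite lee_fin mulr_ge0// exprn_ge0//; lra.
have [uC|uC] := leP (u x) C.
  rewrite max_r ?subr_le0// powR0 ?gt_eqF//; apply: nneseries_ge0 => k _ _; exact: w0.
(* The least m with u x < beta ^ m is at least 3, because u x > C. *)
have exk : exists k, u x < beta ^+ k.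
  exists (Num.truncn (u x)).+1; apply: lt_le_trans (truncnS_gt _) _.
  apply: (@le_trans _ _ (8 ^ (Num.truncn (u x)).+1)%:R).
    by rewrite ler_nat ltnW// ltn_expl.
  by rewrite natrX lerXn2r ?nnegrE//; have := beta8; lra.
have [m um mmin] := ex_minnP exk.
have m2 : (2 < m)%N.
  rewrite ltnNge; apply/negP => m2; move: um; apply/negP; rewrite -leNgt.
  apply: le_trans (ltW uC); apply: le_trans bC.
  by rewrite ler_eXn2l.
case: m m2 um mmin => [|[|[|k]]]// _ um mmin.
have ul : beta ^+ k.+2 <= u x.
  by rewrite leNgt; apply/negP => /mmin; rewrite ltnn.
apply: (@le_trans _ _ ((4 * beta) ^+ k.+3)%:E).
  rewrite lee_fin max_l; last by rewrite subr_ge0 ltW.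
  have -> : (4 * beta) ^+ k.+3 = (beta ^+ k.+3) `^ p.
    have b0 : 0 <= beta by lra.
    rewrite -[X in _ = X `^ p](powR_mulrn _ b0) -powRrM [_ * p]mulrC powRrM beta_powR.
    by rewrite powR_mulrn// mulr_ge0.
  have C0 : 0 <= C by apply: le_trans bC; rewrite sqr_ge0.
  apply: ge0_ler_powR; rewrite ?nnegrE ?(ltW p0)//.
  - by rewrite subr_ge0 ltW.
  - by rewrite exprn_ge0//; lra.
  - by apply: le_trans (ltW um); rewrite gerBl.
apply: le_trans (nneseries_lim_ge k.+1 (fun k _ _ => w0 k)).
rewrite big_nat_recr//= -[leLHS]add0e; apply: leeD; first by apply: sume_ge0 => i _; exact: w0.
by rewrite indicE mem_set//= mulr1.
Qed.

(** The factor 64 beta compares (4 beta) ^ (k + 3) with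
    4 ^ (k + 1) (c_(k+1) - c_k) / 2, using c_(k+1) - c_k >= c_(k+1) / 2. *)
Lemma excess_bound (C : R) : beta ^+ 2 <= C ->
  (\int[mu]_x (Num.max (u x - C) 0 `^ p)%:E <=
   (64 * beta)%:E *
   ((A * n%:R)%:E * torus_variation L u + (128 / 3 / A ^+ 2)%:E * cost))%E.
Proof.
move=> bC.
have mlevel k : measurable (level k).
  have := @mu_ measurableT `[c k.+1, +oo[%classic (measurable_itv _).
  by congr measurable; apply/seteqP; split => x /=; rewrite in_itv/= andbT => // -[].
have w0 k x : (0 <= ((4 * beta) ^+ k.+3 * \1_(level k) x)%:E)%E.
  by rewrite lee_fin mulr_ge0// exprn_ge0//; have := beta8; lra.
have mw k : measurable_fun [set: T] (fun x => ((4 * beta) ^+ k.+3 * \1_(level k) x)%:E).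
  by apply/measurable_EFinP; apply: measurable_funM => //; exact: measurable_indic.
have mmax : measurable_fun [set: T] (fun x => (Num.max (u x - C) 0 `^ p)%:E).
  apply/measurable_EFinP; apply: (measurableT_comp (measurable_powR p)).
  by apply: measurable_maxr => //; exact: measurable_funB.
apply: (@le_trans _ _ (\int[mu]_x (\sum_(0 <= k <oo) ((4 * beta) ^+ k.+3 * \1_(level k) x)%:E))%E).
  apply: ge0_le_integral => //.
  - by move=> x _; rewrite lee_fin powR_ge0.
  - by apply: ge0_emeasurable_sum => // k x _ _; exact: w0.
  - by move=> x _; exact: excess_le_levels.
rewrite integral_nneseries//.
apply: lime_le; first by apply: is_cvg_nneseries => k _ _; exact: integral_ge0.
apply: nearW => K; rewrite big_mkord.
apply: (@le_trans _ _ ((64 * beta)%:E * \sum_(k < K) (4 ^+ k.+1 * ((c k.+1 - c k) / 2))%:E * mu (level k))%E); last first.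
  by apply: lee_wpmul2l; [rewrite lee_fin; have := beta8; lra|exact: level_sum].
have cd k : 0 <= 4 ^+ k.+1 * ((c k.+1 - c k) / 2).
  by rewrite mulr_ge0 ?exprn_ge0// divr_ge0// subr_ge0.
rewrite ge0_sume_distrr; last by move=> k _; rewrite mule_ge0// lee_fin.
apply: lee_sum => k _.
rewrite (eq_integral (fun x => ((4 * beta) ^+ k.+3)%:E * (\1_(level k) x : R)%:E)%E); last first.
  by move=> x _; rewrite EFinM.
rewrite ge0_integralZl//; first last.
- by rewrite lee_fin exprn_ge0//; have := beta8; lra.
- by apply/measurable_EFinP; exact: measurable_indic.
rewrite integral_indic// setIT muleA -EFinM; apply: lee_wpmul2r => //.
rewrite lee_fin /c exprMn !(exprS _ k.+2) !(exprS _ k.+1).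
have b0 : 0 <= beta ^+ k.+1 by rewrite exprn_ge0//; have := beta8; lra.
have f0 : 0 <= 4 ^+ k.+1 :> R by rewrite exprn_ge0.
have H : 0 <= 4 ^+ k.+1 * (beta * (beta ^+ k.+1 * (beta - 2))).
  by have := beta8 => ?; rewrite !mulr_ge0//; lra.
move: H; set X := beta ^+ k.+1; set Y := 4 ^+ k.+1; move=> H.
rewrite -subr_ge0.
have -> : 64 * beta * (Y * ((beta * X - X) / 2)) - 4 * (4 * Y) * (beta * (beta * X)) =
  16 * (Y * (beta * (X * (beta - 2)))) by field.
by rewrite mulr_ge0.
Qed.

End summation.

(** * Optimisation of the scale *)

(** For positive V and W the optimal scale, up to a constant, is
    A = (W / V) ^ (1/3), which makes both terms equal.  If V or W vanishes, the
    same bound is the limit A -> +oo, respectively A -> 0. *)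
Lemma optimize_scale (R : realType) (N K V W : R) : 0 <= V -> 0 <= W -> 0 <= K ->
  (forall A, 0 < A -> N <= K * (A * V + W / A ^+ 2)) ->
  N <= 2 * K * (V `^ (2 / 3) * W `^ (1 / 3)).
Proof.
move=> V0 W0 K0 H.
have rhs0 : 0 <= 2 * K * (V `^ (2 / 3) * W `^ (1 / 3)) by rewrite !mulr_ge0 ?powR_ge0.
have [N0|N0] := leP N 0; first exact: le_trans rhs0.
move: V0; rewrite le_eqVlt => /orP[/eqP V0|V0].
  (* For V = 0 this A >= 1 exceeds K W / N, so that K W / A ^ 2 < N. *)
  have A1 : 1 <= 1 + K * W / N by rewrite lerDl divr_ge0 ?mulr_ge0// ltW.
  have := H (1 + K * W / N) (lt_le_trans ltr01 A1).
  rewrite -V0 mulr0 add0r mulrA ler_pdivlMr ?exprn_gt0 ?(lt_le_trans ltr01)//.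
  have : K * W < N * (1 + K * W / N) by rewrite mulrDr mulr1 mulrCA divff ?gt_eqF// mulr1 ltrDr.
  have : N * (1 + K * W / N) <= N * (1 + K * W / N) ^+ 2.
    by rewrite ler_pM2l// expr2 ler_peMr// (le_trans ler01).
  by lra.
move: W0; rewrite le_eqVlt => /orP[/eqP W0|W0].
  (* For W = 0, the scale N / (2 K V + 1) makes K A V smaller than N. *)
  have D0 : 0 < 2 * (K * V) + 1 by rewrite ltr_wpDl// mulr_ge0// mulr_ge0// ltW.
  have := H (N / (2 * (K * V) + 1)) (divr_gt0 N0 D0).
  rewrite -W0 mul0r addr0 mulrCA -mulrA mulrC.
  have : N / (2 * (K * V) + 1) * (2 * (K * V) + 1) = N by rewrite divfK ?gt_eqF.
  have := mulr_ge0 K0 (ltW V0); have := divr_gt0 N0 D0.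
  set q := N / _; set KV := K * V; nra.
have := H (W `^ (1 / 3) / V `^ (1 / 3)).
have v0 : 0 < V `^ (1 / 3) by rewrite powR_gt0.
have w0 : 0 < W `^ (1 / 3) by rewrite powR_gt0.
have cube (x : R) : 0 < x -> x = (x `^ (1 / 3)) ^+ 3.
  move=> x0; rewrite -powR_mulrn ?powR_ge0// -powRrM (_ : 1 / 3 * 3%:R = 1) ?powRr1 ?ltW//.
  by field.
have -> : V `^ (2 / 3) = (V `^ (1 / 3)) ^+ 2.
  by rewrite -powR_mulrn ?powR_ge0// -powRrM; congr (_ `^ _); field.
move=> /(_ (divr_gt0 w0 v0)) /le_trans; apply.
rewrite {2}(cube V V0) {2}(cube W W0).
rewrite le_eqVlt; apply/orP; left; apply/eqP; field.
by rewrite !gt_eqF.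
Qed.

(** A coupling is an arbitrary measure, and its mass is finite because u has
    finite mass; taking the proof of finiteness as an argument allows the copy
    to carry the structure of a finite measure that Fubini asks for. *)
Section as_finite.
Context {d} {S : measurableType d} {R : realType}.
Variable m : {measure set S -> \bar R}.

Definition as_finite (fin_m : fin_num_fun m) : set S -> \bar R := m.

Variable fin_m : fin_num_fun m.

HB.instance Definition _ := Measure.on (as_finite fin_m).

HB.instance Definition _ :=
  Measure_isFinite.Build _ _ _ (as_finite fin_m) fin_m.

End as_finite.

Section coupling_mass.
Context {R : realType} {n : nat} (L : R).
Local Notation T := ('rV[R]_n).
Local Notation mu := (@torus_measure R n L).

Lemma coupling_finite (u v : T -> R) (gam : {measure set (T * T)%type -> \bar R}) :
  coupling L u v gam -> (\int[mu]_x (u x)%:E < +oo)%E -> fin_num_fun gam.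
Proof.
move=> cg ufin; apply: lty_fin_num_fun.
by have [] := cg setT measurableT; rewrite preimage_setT => ->.
Qed.

Lemma W2sq_ge0 (u v : T -> R) : (0 <= W2sq L u v)%E.
Proof.
apply: le_ereal_inf_tmp => _ [gam _ <-]; apply: integral_ge0 => z _.
by rewrite lee_fin sqr_ge0.
Qed.

(** [excess_bound] for couplings whose cost is arbitrarily close to the infimum,
    all with the same A. *)
Lemma excess_bound_W2sq (u : T -> R) (C A : R) : (0 < n)%N -> 0 < L ->
  measurable_fun [set: T] u -> lattice_periodic L u -> (forall x, 0 <= u x) ->
  mu.-integrable setT (EFin \o u) -> (torus_variation L u < +oo)%E ->
  (W2sq L u (cst 1%R) < +oo)%E -> 0 < A -> (8 ^+ n) ^+ 2 <= C ->
  (\int[mu]_x (Num.max (u x - C) 0 `^ ((2 + 3 * n%:R) / (3 * n%:R)))%:E <=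
   (64 * 8 ^+ n * ((A * n%:R) * fine (torus_variation L u) +
     128 / 3 / A ^+ 2 * fine (W2sq L u (cst 1%R))))%:E)%E.
Proof.
move=> n0 L0 mu_ pu u0 iu Vfin Wfin A0 bC.
have b0 : 0 < 8 ^+ n :> R by rewrite exprn_gt0.
apply/lee_addgt0Pr => e e0.
have WE : W2sq L u (cst 1%R) = (fine (W2sq L u (cst 1%R)))%:E.
  by rewrite fineK// ge0_fin_numE ?W2sq_ge0.
have VE : torus_variation L u = (fine (torus_variation L u))%:E.
  by rewrite fineK// ge0_fin_numE ?torus_variation_ge0.
have s0 : 0 < 64 * 8 ^+ n * (128 / 3 / A ^+ 2) :> R.
  by rewrite !mulr_gt0 ?invr_gt0 ?exprn_gt0.
have [_ [gam cgam <-]] : exists2 y, [set (\int[gamma]_z (torus_dist L z.1 z.2 ^+ 2)%:E)%E |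
    gamma in coupling L u (cst 1%R)] y &
    (y < (fine (W2sq L u (cst 1%R)) + e / (64 * 8 ^+ n * (128 / 3 / A ^+ 2)))%:E)%E.
  by apply: ereal_inf_lt; rewrite -/(W2sq L u (cst 1%R)) [X in (X < _)%E]WE lte_fin ltrDl divr_gt0.
have ufin : (\int[mu]_x (u x)%:E < +oo)%E.
  have /integrableP[_] := iu; congr (_ < _)%E; apply: eq_integral => x _ /=.
  by rewrite ger0_norm.
pose gf : {finite_measure set (T * T)%type -> \bar R} := as_finite (coupling_finite cgam ufin).
move=> cost_lt.
apply: le_trans (@excess_bound R n L u gf n0 L0 mu_ pu u0 iu Vfin cgam A A0 C bC) _.
rewrite -EFinD; rewrite [torus_variation L u]VE.
have cost0 : (0 <= \int[gam]_z (torus_dist L z.1 z.2 ^+ 2)%:E)%E.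
  by apply: integral_ge0 => z _; rewrite lee_fin sqr_ge0.
apply: (@le_trans _ _ ((64 * 8 ^+ n)%:E * ((A * n%:R)%:E * (fine (torus_variation L u))%:E +
   (128 / 3 / A ^+ 2)%:E * (fine (W2sq L u (cst 1%R)) + e / (64 * 8 ^+ n * (128 / 3 / A ^+ 2)))%:E))%E).
  apply: lee_wpmul2l; first by rewrite lee_fin mulr_ge0 ?ltW.
  apply: leeD => //; apply: lee_wpmul2l; last exact: ltW.
  by rewrite lee_fin !divr_ge0// sqr_ge0.
rewrite -!EFinM lee_fin/= le_eqVlt; apply/orP; left; apply/eqP.
set V := fine _; set W := fine _; set N : R := n%:R; set b := 8 ^+ n; field.
by rewrite !gt_eqF.
Qed.

End coupling_mass.

Theorem proposition1p3 (R : realType) (d : nat) (hd : (0 < d)%N) :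
  exists C : R, 0 < C /\
    forall (L : R) (u : 'rV[R]_d -> R),
      0 < L ->
      measurable_fun [set: 'rV[R]_d] u ->
      lattice_periodic L u ->
      (forall x, 0 <= u x) ->
      ((L ^- d)%:E * \int[torus_measure L]_x (u x)%:E = 1)%E ->
      (torus_variation L u < +oo)%E ->
      (W2sq L u (cst 1%R) < +oo)%E ->
      ('N[torus_measure L]_(((2 + 3 * d%:R) / (3 * d%:R))%:E)
          [(fun x => (Num.max (u x - C) 0)%:E)]
        <= C%:E * torus_variation L u `^ (2 * d%:R / (2 + 3 * d%:R))
             * W2sq L u (cst 1%R) `^ (d%:R / (2 + 3 * d%:R)))%E.
Proof.
pose beta : R := 8 ^+ d.
have beta1 : 1 <= beta by rewrite exprn_ege1// ler1n.
have d1 : 1 <= d%:R :> R by rewrite ler1n.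
(* K dominates 64 beta max(d, 128 / 3); C must exceed both the cut-off beta ^ 2
   of the level sum and the factor 2 K of the optimisation. *)
pose K : R := 64 * 64 * d%:R * beta.
have K1 : 1 <= 2 * K.
  have := ler_pM ler01 ler01 d1 beta1; rewrite mulr1 /K -!mulrA => ?; lra.
pose C : R := 8192 * d%:R * beta ^+ 2.
have bC : beta ^+ 2 <= C.
  by rewrite /C ler_peMl ?sqr_ge0//; lra.
have KC : 2 * K <= C.
  have -> : C = 2 * K * beta by rewrite /C /K; ring.
  by rewrite ler_peMr//; lra.
exists C; split; first by lra.
move=> L u L0 mu_ pu u0 mass Vfin Wfin.
have ufin : (\int[torus_measure L]_x (u x)%:E < +oo)%E.
  rewrite ltNge leye_eq; apply/eqP => uoo; move: mass.
  by rewrite uoo gt0_muley// lte_fin invr_gt0 exprn_gt0.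
have iu : (torus_measure L).-integrable setT (EFin \o u).
  apply/integrableP; split; first exact/measurable_EFinP.
  move: ufin; congr (_ < _)%E; apply: eq_integral => x _ /=.
  by rewrite ger0_norm.
have V0 := torus_variation_ge0 L u; have W0 := W2sq_ge0 L u (cst 1).
have VE : torus_variation L u = (fine (torus_variation L u))%:E.
  by rewrite fineK// ge0_fin_numE.
have WE : W2sq L u (cst 1%R) = (fine (W2sq L u (cst 1%R)))%:E.
  by rewrite fineK// ge0_fin_numE.
set V := fine (torus_variation L u) in VE; set W := fine (W2sq L u (cst 1%R)) in WE.
have V0' : 0 <= V by exact: fine_ge0.
have W0' : 0 <= W by exact: fine_ge0.
set p : R := (2 + 3 * d%:R) / (3 * d%:R).
set I := (\int[torus_measure L]_x (Num.max (u x - C) 0 `^ p)%:E)%E.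
have bound A : 0 < A -> (I <= (K * (A * V + W / A ^+ 2))%:E)%E.
  move=> A0; apply: le_trans (excess_bound_W2sq hd L0 mu_ pu u0 iu Vfin Wfin A0 bC) _.
  rewrite lee_fin -/V -/W -/beta.
  have -> : K * (A * V + W / A ^+ 2) = 64 * beta * (A * d%:R * V * 64 + d%:R * 64 * (W / A ^+ 2)).
    by rewrite /K; ring.
  rewrite ler_wpM2l//; first by lra.
  have AV : 0 <= A * d%:R * V by rewrite !mulr_ge0// ltW.
  have AW : 0 <= W / A ^+ 2 by rewrite divr_ge0// sqr_ge0.
  apply: lerD; first lra.
  by rewrite mulrAC -mulrA ler_wpM2r//; lra.
have I0 : (0 <= I)%E by apply: integral_ge0 => x _; rewrite lee_fin powR_ge0.
have IE : I = (fine I)%:E.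
  by rewrite fineK// ge0_fin_numE//; apply: le_lt_trans (bound 1 ltr01) _; rewrite ltry.
have opt : fine I <= 2 * K * (V `^ (2 / 3) * W `^ (1 / 3)).
  apply: optimize_scale => // [|A A0]; first by lra.
  by rewrite -lee_fin -IE bound.
have p0 : 0 < p by rewrite divr_gt0//; lra.
have -> : ('N[torus_measure L]_p%:E [(fun x => (Num.max (u x - C) 0)%:E)] =
    (fine I `^ p^-1)%:E)%E.
  rewrite unlock /= -poweR_EFin -IE; congr (_ `^ _)%E.
  apply: eq_integral => x _.
  by rewrite ger0_norm// le_max lexx orbT.
rewrite VE WE !poweR_EFin -!EFinM lee_fin.
have pV : p^-1 = 3 * d%:R / (2 + 3 * d%:R) by rewrite /p invf_div.
apply: (@le_trans _ _ ((2 * K * (V `^ (2 / 3) * W `^ (1 / 3))) `^ p^-1)).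
  apply: ge0_ler_powR; rewrite ?nnegrE ?invr_ge0 ?(ltW p0) ?fine_ge0//.
  by rewrite !mulr_ge0 ?powR_ge0//; lra.
have K0 : 0 <= 2 * K by lra.
rewrite (powRM _ K0 (mulr_ge0 (powR_ge0 _ _) (powR_ge0 _ _))).
rewrite (powRM _ (powR_ge0 _ _) (powR_ge0 _ _)).
rewrite -!powRrM mulrA pV.
have -> : 2 / 3 * (3 * d%:R / (2 + 3 * d%:R)) = 2 * d%:R / (2 + 3 * d%:R) :> R.
  by field; lra.
have -> : 1 / 3 * (3 * d%:R / (2 + 3 * d%:R)) = d%:R / (2 + 3 * d%:R) :> R.
  by field; lra.
do 2 (apply: ler_wpM2r; first exact: powR_ge0).
by apply: le_trans KC; apply: ler1_powR => //; rewrite ler_pdivrMr; lra.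
Qed.
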